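(* Let $p$ be a positive integer and let $a_1,\ldots,a_{2p-1}$ be real, distinct, non-zero numbers, with $A_j:=A(a_j)$, $P_a$ and $M_{m,p,a}$ as defined below. For each integer $m\ge0$, the Fischer operator $F_a:\mathcal P_m\to\mathcal P_m$, $F_a(q):=\Delta^p(P_aq)$, is a bijection if and only if $\det M_{m,p,a}\neq0$. Moreover, there is a constant $C\ge0$, independent of $m$, such that whenever $\det M_{m,p,a}\ne0$, $$\|P_aq\|\leq\frac{C}{|\det M_{m,p,a}|}\,\|\Delta^p(P_aq)\|\quad\text{for all } q\in\mathcal P_m.$$
   Context: $\mathcal P_m$ is the space of homogeneous polynomials of degree $m$ in $(x,y)$ with complex coefficients. $\|\cdot\|$ is the norm of the real Fischer inner product $\langle f,g\rangle=\int_{\mathbb R^2}f(x,y)\overline{g(x,y)}e^{-(x^2+y^2)}\,dx\,dy$ on $\mathbb C[x,y]$. $\Delta=\partial_x^2+\partial_y^2$. For real $a$, $A(a):=\frac{a+i}{a-i}$. $P_a(x,y):=y\prod_{j=1}^{2p-1}(x-a_jy)$. For $m\ge0$, $M_{m,p,a}$ is the $2p\times2p$ matrix whose first row is $(1,\ldots,1)$ and whose $(j+1)$-th row, $j=1,\ldots,2p-1$, is $(1,A_j,\ldots,A_j^{p-1},A_j^{m+p+1},\ldots,A_j^{m+2p})$. *)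

(* Defs.v *)
From HB Require Import structures.
From mathcomp Require Import all_boot all_order all_algebra.
From mathcomp Require Import all_classical all_reals all_analysis.
From mathcomp.real_closed Require Import complex.
Set Implicit Arguments. Unset Strict Implicit. Unset Printing Implicit Defensive.
Import Order.TTheory GRing.Theory Num.Theory.
Local Open Scope ring_scope.

(* Bivariate polynomials in (x,y): outer variable is y, inner variable is x.
   The monomial x^i y^j is the coefficient (p`_j)`_i. *)
Notation bipoly R := {poly {poly R[i]}}.

Section Defs.
Variable R : realType.

Definition bx : bipoly R := ('X : {poly R[i]})%:P.
Definition by_ : bipoly R := 'X.

Definition homog (m : nat) (f : bipoly R) : Prop :=
  forall i j : nat, (f`_j)`_i != 0 -> (i + j)%N = m.

Definition lap (f : bipoly R) : bipoly R :=
  map_poly (fun c : {poly R[i]} => c^`(2)) f + f^`(2).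

Definition bieval (f : bipoly R) (x y : R) : R[i] :=
  (map_poly (fun c : {poly R[i]} => c.[(x%:C)%C]) f).[(y%:C)%C].

Definition sqmod (z : R[i]) : R := complex.Re z ^+ 2 + complex.Im z ^+ 2.

Definition fnorm (f : bipoly R) : R :=
  Num.sqrt (fine (\int[(@lebesgue_measure R \x @lebesgue_measure R)%E]_(z in [set: R * R])
     ((sqmod (bieval f z.1 z.2) * expR (- (z.1 ^+ 2 + z.2 ^+ 2)))%:E))).

Definition Acoef (a : R) : R[i] := ((a%:C)%C + 'i%C) / ((a%:C)%C - 'i%C).

Definition Pa (p : nat) (a : nat -> R) : bipoly R :=
  by_ * \prod_(1 <= j < p.*2) (bx - (((a j)%:C)%C)%:P%:P * by_).

Definition Mmat (m p : nat) (a : nat -> R) : 'M[R[i]]_(p.*2) :=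
  \matrix_(j < p.*2, c < p.*2)
    if j == 0 :> nat then 1
    else if (c < p)%N then Acoef (a j) ^+ c
    else Acoef (a j) ^+ (m + c + 1).

Definition Fop (p : nat) (a : nat -> R) (q : bipoly R) : bipoly R :=
  iter p lap (Pa p a * q).

End Defs.

Definition cabs (R : realType) (z : R[i]) : R := Num.sqrt (sqmod z).

(* Main.v *)
Require Import Defs.
From HB Require Import structures.
From mathcomp Require Import all_boot all_order all_algebra.
From mathcomp Require Import all_classical all_reals all_analysis.
From mathcomp.real_closed Require Import complex.
From mathcomp Require Import perm measurable_realfun ring lra zify.
Import Order.TTheory GRing.Theory Num.Theory.
Import numFieldNormedType.Exports.
Set Implicit Arguments. Unset Strict Implicit. Unset Printing Implicit Defensive.
Local Open Scope classical_set_scope.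
Local Open Scope ring_scope.

(* In the coordinates z = x + iy, w = x - iy a form of degree n is
   sum_k c_k z^k w^(n-k), and Delta = 4 d_z d_w kills exactly the monomials with
   k < p or k > n - p when raised to the power p.  Up to a scalar, P_a is
   (z - w) prod_j (z - A_j w), so a form is a multiple of P_a iff its coefficient
   polynomial c vanishes at 1 and at the A_j.  These 2p equations, solved for the
   2p coefficients killed by Delta^p, form a linear system with matrix M_{m,p,a}:
   this gives the bijectivity criterion, and Cramer's rule (|A_j| = 1) bounds the
   killed coefficients by (2p)!/|det M| times the l^1 norm of the others.

   Gaussian integration by parts shows that the z^k w^(n-k) are orthogonal of norm
   squared pi n!, so all norms are weighted l^2 norms of coefficients.  The l^1 norm
   is controlled by Cauchy-Schwarz, and the constant is independent of m because
   (m+2p)!/m! sum_t ((t+1)...(t+p) (m-t+1)...(m-t+p))^(-2) is bounded in m. *)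

(** * Gaussian moments on the line and the plane *)

Section GaussianMoments.
Variable R : realType.
Local Notation mu := (@lebesgue_measure R).

Definition gauss_monomial k (x : R) : R := x ^+ k * gauss_fun x.

(** Half of the Gaussian exponent absorbs the power: with [t = x^2/2], a single term of the
    exponential series gives [t^(k+1) <= (k+1)! e^t]. *)
Lemma gauss_monomial_bound k : exists2 C : R, 0 <= C &
  forall x, `|gauss_monomial k x| <= C * expR (- x ^+ 2 / 2).
Proof.
pose c : R := 2 ^+ k.+1 * k.+1`!%:R.
have c0 : 0 <= c by rewrite mulr_ge0 ?exprn_ge0 ?ler0n.
exists (1 + c) => [|x]; first by rewrite addr_ge0.
rewrite /gauss_monomial /gauss_fun normrM normrX (ger0_norm (expR_ge0 _)).
have -> : expR (- x ^+ 2) = expR (- x ^+ 2 / 2) * expR (- x ^+ 2 / 2).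
  by rewrite -expRD -splitr.
rewrite mulrA ler_wpM2r ?expR_ge0//.
rewrite mulNr expRN ler_pdivrMr ?expR_gt0//.
set t := x ^+ 2 / 2.
have t0 : 0 <= t by rewrite divr_ge0 ?sqr_ge0.
have x2t : `|x| ^+ 2 = 2 * t by rewrite real_normK ?num_real// /t mulrC divfK.
have bt : t ^+ k.+1 <= k.+1`!%:R * expR t.
  rewrite -ler_pdivrMl ?ltr0n ?fact_gt0// mulrC.
  by apply: le_trans (expR_ge1Dxn k t0); rewrite lerDr.
have e1 : 1 <= expR t by rewrite -expR0 ler_expR.
rewrite mulrDl mul1r.
(* For [|x| <= 1] the power is at most [1 <= e^t]; otherwise it is raised to the even exponent
   [2(k+1)], which is a power of [t]. *)
have [x1|x1] := leP `|x| 1.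
  apply: (@le_trans _ _ 1); first by rewrite exprn_ile1.
  by rewrite (le_trans e1)// lerDl mulr_ge0 ?expR_ge0.
apply: (@le_trans _ _ (`|x| ^+ (2 * k.+1))).
  by apply: ler_weXn2l; rewrite ?(ltW x1)//; lia.
rewrite exprM x2t exprMn (@le_trans _ _ (c * expR t))//.
  by rewrite /c -mulrA ler_wpM2l ?exprn_ge0.
by rewrite lerDr expR_ge0.
Qed.

Lemma continuous_gauss_monomial k : continuous (gauss_monomial k).
Proof.
by move=> x; apply: cvgM; [exact: exprn_continuous|exact: continuous_gauss_fun].
Qed.

Lemma measurable_gauss_monomial k : measurable_fun setT (gauss_monomial k).
Proof. by apply: measurable_funM => //; exact: measurable_gauss_fun. Qed.

Lemma integrable_gauss_monomial k :
  mu.-integrable setT (EFin \o gauss_monomial k).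
Proof.
have [C C0 bC] := gauss_monomial_bound k.
have pk0 : 0 < normal_peak (1 : R) by rewrite normal_peak_gt0 ?oner_eq0.
(* The majorant [exp(-x^2/2)] is the standard normal density divided by its peak value. *)
apply: (@le_integrable _ _ _ mu setT measurableT _
  (fun x => (C / normal_peak 1)%:E * (normal_pdf 0 1 x)%:E)%E).
- by apply/measurable_EFinP; exact: measurable_gauss_monomial.
- move=> x _; rewrite -EFinM !abse_EFin lee_fin.
  apply: le_trans (bC x) _; apply: le_trans (ler_norm _).
  rewrite /normal_pdf (negbTE (oner_neq0 _)) /normal_fun subr0 expr1n.
  by rewrite mulrA divfK ?gt_eqF.
- exact/integrableZl/integrable_normal_pdf.
Qed.

Lemma is_derive_gauss_monomial k (x : R) : is_derive x 1 (gauss_monomial k)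
  (k%:R * gauss_monomial k.-1 x - 2 * gauss_monomial k.+1 x).
Proof.
have d1 : is_derive x 1 (fun y : R => - y ^+ 2) (- (2 * x)).
  by apply: is_derive_eq; rewrite -[x *: _]/(x * 1) mulr1 mulr_natl.
have dg : is_derive x 1 (@gauss_fun R) (- (2 * x) * gauss_fun x).
  by apply: is_derive_eq (is_derive1_comp (is_derive_expR _) d1) _; rewrite mulrC.
have dX : is_derive x 1 (fun y : R => y ^+ k) (k%:R * x ^+ k.-1).
  apply: DeriveDef; first exact: exprn_derivable.
  by rewrite exp_derive [LHS]mulr1.
apply: is_derive_eq (is_deriveM dX dg) _.
rewrite /gauss_monomial -![_ *: _]/(_ * _) exprS.
ring.
Qed.

(** The integral over [[-n, n]] is [F n - F (-n)], at most [2C/n] in modulus; dominated convergence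
    with majorant [|f|] passes to the whole line. *)
Lemma integral_derivative_eq0 (F f : R -> R) (C : R) :
  continuous f -> (forall x : R, is_derive x 1 F (f x)) ->
  (forall x, `|x * F x| <= C) -> mu.-integrable setT (EFin \o f) ->
  \int[mu]_x f x = 0.
Proof.
move=> cf dF bF intf.
have cF : continuous F.
  move=> x; apply: differentiable_continuous; apply/derivable1_diffP.
  exact: (@ex_derive _ _ _ _ _ _ _ (dF x)).
pose f_ (n : nat) : R -> \bar R := (EFin \o f) \_ `[- n%:R, n%:R].
have mf : measurable_fun setT (EFin \o f).
  by apply/measurable_EFinP; exact: continuous_measurable_fun.
have mf_ n : measurable_fun setT (f_ n).
  apply/(measurable_restrictT _ _).1 => //.
  exact: measurable_funTS.
have f_f : {ae mu, forall x, setT x -> f_ ^~ x @ \oo --> (EFin \o f) x}.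
  apply: aeW => x _; apply: cvg_near_cst.
  near=> n; rewrite /f_ patchE ifT// inE/= in_itv/= -ler_norml.
  by near: n; exact: nbhs_infty_ger.
have f_le : {ae mu, forall x n, setT x -> `|f_ n x| <= `|f x|%:E}%E.
  apply: aeW => x n _; rewrite /f_ patchE; case: ifPn => _ //=.
  by rewrite normr0 lee_fin.
have [_ _ f_cvg] := @dominated_convergence _ _ _ mu setT measurableT
  f_ (EFin \o f) (fun x => `|f x|%:E) mf_ mf f_f (integrable_norm intf) f_le.
have f_0 : [sequence (\int[mu]_x f_ n x)%E]_n @ \oo --> (0%E : \bar R).
  apply/cvg_abse0P.
  have bnd : (fun n : nat => (C *+ 2 / n%:R)%:E) @ \oo --> (0%E : \bar R).
    apply: cvg_EFin; first by apply: nearW.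
    rewrite -[X in _ --> X](mulr0 (C *+ 2)); apply: cvgMr.
    apply/gtr0_cvgV0; last exact: cvgr_idn.
    by near=> n; rewrite ltr0n; near: n; exact: nbhs_infty_gt.
  apply: squeeze_cvge (cvg_cst 0%E) bnd.
  near=> n; rewrite abse_ge0/=.
  have n0 : (0 : R) < n%:R by near: n; exact: nbhs_infty_gtr.
  have nn : - n%:R < n%:R :> R by rewrite (lt_trans _ n0)// oppr_lt0.
  rewrite -integral_mkcond (@continuous_FTC2 _ f F)//; first last.
  - by move=> x _; rewrite derive1E; exact: (@derive_val _ _ _ _ _ _ _ (dF x)).
  - split.
    + by move=> x _; exact: (@ex_derive _ _ _ _ _ _ _ (dF x)).
    + by apply: cvg_at_right_filter; exact: cF.
    + by apply: cvg_at_left_filter; exact: cF.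
  - exact: continuous_subspaceT.
  rewrite -EFinB abse_EFin lee_fin ler_pdivlMr// -[X in _ * X](gtr0_norm n0) -normrM.
  rewrite mulrBl -[X in _ - X]opprK -mulrN -(mulrC n%:R) -(mulrC (- n%:R)) opprK mulr2n.
  by rewrite (le_trans (ler_normD _ _))// lerD.
have := cvg_unique _ f_cvg f_0; rewrite /Rintegral => -> //.
Unshelve. all: end_near.
Qed.

Definition gmoment k : R := \int[mu]_x gauss_monomial k x.

(* For k = 0 the truncated k.-1 is harmless: both sides vanish. *)
Lemma gmoment_rec k : gmoment k.+1 *+ 2 = k%:R * gmoment k.-1.
Proof.
have i1 : mu.-integrable setT (EFin \o (fun x => k%:R * gauss_monomial k.-1 x)).
  exact: (integrableZl measurableT k%:R (integrable_gauss_monomial k.-1)).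
have i2 : mu.-integrable setT (EFin \o (fun x => 2 * gauss_monomial k.+1 x)).
  exact: (integrableZl measurableT 2 (integrable_gauss_monomial k.+1)).
have [C C0 bC] := gauss_monomial_bound k.+1.
have := @integral_derivative_eq0 (gauss_monomial k) _ C _
  (is_derive_gauss_monomial k).
rewrite RintegralB// !RintegralZl//; [|exact: integrable_gauss_monomial..].
move=> h; apply/esym/subr0_eq; rewrite -[X in _ - X]mulr_natl; apply: h.
- by move=> x; apply: cvgB; apply: cvgMr; exact: continuous_gauss_monomial.
(* The extra factor [x] turns the primitive into the next Gaussian monomial, which is bounded. *)
- move=> x; rewrite /gauss_monomial mulrA -exprS.
  apply: le_trans (bC x) _; rewrite ler_piMr// -expR0 ler_expR.
  by rewrite mulNr oppr_le0 divr_ge0 ?sqr_ge0.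
- exact: (integrableB measurableT i1 i2).
Qed.

Lemma gmoment0_gt0 : 0 < gmoment 0.
Proof.
rewrite /gmoment /Rintegral.
under eq_integral do rewrite /gauss_monomial expr0 mul1r.
by rewrite integralT_gauss/= sqrtr_gt0 pi_gt0.
Qed.

Local Open Scope ereal_scope.

Lemma integral_gauss_monomial k :
  \int[mu]_x (gauss_monomial k x)%:E = (gmoment k)%:E.
Proof.
rewrite /gmoment /Rintegral fineK//.
exact: (integrable_fin_num measurableT (integrable_gauss_monomial k)).
Qed.

(** Integrability is Tonelli's criterion on absolute values; Fubini then separates the variables.
    The integrand is specified pointwise so that it can be matched whatever its syntactic form. *)
Lemma integral_gauss_monomial2 i j (f : R * R -> \bar R) :
  (forall z, f z = (gauss_monomial i z.1 * gauss_monomial j z.2)%:E) ->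
  (mu \x mu).-integrable setT f /\
  \int[mu \x mu]_z f z = (gmoment i * gmoment j)%:E.
Proof.
move=> /funext ->.
have inorm k : mu.-integrable setT (fun x => `|gauss_monomial k x|%:E).
  exact/integrable_norm/integrable_gauss_monomial.
have absmoment k : exists M : R, \int[mu]_y `|gauss_monomial k y|%:E = M%:E.
  exists (fine (\int[mu]_y `|gauss_monomial k y|%:E)); rewrite fineK//.
  exact: (integrable_fin_num measurableT).
have [[Mi iM] [Mj jM]] := (absmoment i, absmoment j).
have f_int : (mu \x mu).-integrable setT
    (fun z : R * R => (gauss_monomial i z.1 * gauss_monomial j z.2)%:E).
  apply/integrable12ltyP.
    apply/measurable_EFinP; apply: measurable_funM.
      by apply: measurableT_comp; [exact: measurable_gauss_monomial|].
    by apply: measurableT_comp; [exact: measurable_gauss_monomial|].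
  under eq_integral => x _.
    under eq_integral => y _ do rewrite /= normrM EFinM.
    rewrite integralZl//= jM muleC; over.
  by rewrite integralZl// iM -EFinM ltry.
split=> //.
rewrite -(integral12_prod_meas1 f_int) /fubini_F/=.
under eq_integral => x _.
  under eq_integral => y _ do rewrite EFinM.
  rewrite integralZl//=; last exact: integrable_gauss_monomial.
  rewrite integral_gauss_monomial muleC; over.
rewrite integralZl//=; last exact: integrable_gauss_monomial.
by rewrite integral_gauss_monomial muleC EFinM.
Qed.

End GaussianMoments.

(** * Differential operators in the coordinates z and w *)

Section UmbralFunctional.
Variables (F : fieldType) (u : nat -> F).

(** Formal integration against the moments [u]: whatever follows from a recurrence for [u] becomes
    pure algebra. *)
Definition umbral (c : {poly F}) : F := \sum_(i < size c) c`_i * u i.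

Lemma umbralE N (c : {poly F}) : (size c <= N)%N ->
  umbral c = \sum_(i < N) c`_i * u i.
Proof.
move=> sN; rewrite /umbral (big_ord_widen _ (fun i => c`_i * u i) sN).
rewrite big_mkcond/=; apply: eq_bigr => i _; case: ltnP => // si.
by rewrite nth_default ?mul0r.
Qed.

Lemma umbral_is_linear k : {morph umbral : c d / k *: c + d >-> k * c + d}.
Proof.
move=> c d; set N := maxn (size c) (size d).
rewrite !(@umbralE N) ?leq_maxr ?leq_maxl//; last first.
  rewrite (leq_trans (size_polyD _ _))// geq_max leq_maxr andbT.
  by rewrite (leq_trans (size_scale_leq _ _)) ?leq_maxl.
rewrite mulr_sumr -big_split/=; apply: eq_bigr => i _.
by rewrite coefD coefZ mulrDl mulrA.
Qed.

Lemma umbralD : {morph umbral : c d / c + d}.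
Proof. by move=> c d; rewrite -[c]scale1r umbral_is_linear mul1r scale1r. Qed.

Lemma umbral0 : umbral 0 = 0.
Proof. by rewrite /umbral size_poly0 big_ord0. Qed.

Lemma umbralZ k c : umbral (k *: c) = k * umbral c.
Proof. by rewrite -[_ *: _]addr0 umbral_is_linear umbral0 addr0. Qed.

Lemma umbralB : {morph umbral : c d / c - d}.
Proof. by move=> c d; rewrite -scaleN1r umbralD umbralZ mulN1r. Qed.

Lemma umbral1 : umbral 1 = u 0%N.
Proof. by rewrite (@umbralE 1) ?size_poly1// big_ord1 coef1 mul1r. Qed.

(** Integration by parts in algebraic form: the recurrence on [u] is this identity for the powers of
    [X], and both sides are linear in [c]. *)
Lemma umbral_mulX (c : {poly F}) :
  (forall k, u k.+1 *+ 2 = k%:R * u k.-1) ->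
  umbral ('X * c) *+ 2 = umbral c^`().
Proof.
move=> rec_u; set N := size c.
rewrite (@umbralE N.+1); last by rewrite (leq_trans (size_polyMleq _ _))// size_polyX.
rewrite (@umbralE N (c^`())); last exact: (leq_trans (size_poly _ _) (leq_pred _)).
rewrite big_ord_recl coefXM/= mul0r add0r -sumrMnl.
rewrite (eq_bigr (fun i : 'I_N => c`_i *+ i * u i.-1)); last first.
  by move=> i _; rewrite coefXM/= -mulrnAr rec_u mulrA mulr_natr.
rewrite -(big_mkord xpredT (fun i => c`_i *+ i * u i.-1)).
rewrite -(big_mkord xpredT (fun i => c^`()`_i * u i)).
(* A vanishing term is added at the top so that splitting off the vanishing term [i = 0] leaves the
   shifted sum of the derivative. *)
have -> : \sum_(0 <= i < N) c`_i *+ i * u i.-1 =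
          \sum_(0 <= i < N.+1) c`_i *+ i * u i.-1.
  by rewrite big_nat_recr//= [c`_N]nth_default// mul0rn mul0r addr0.
rewrite big_nat_recl// mulr0n mul0r add0r.
by apply: eq_bigr => i _; rewrite coef_deriv.
Qed.

End UmbralFunctional.

HB.instance Definition _ (F : fieldType) (u : nat -> F) :=
  GRing.isAdditive.Build {poly F} F (umbral u) (@umbralB F u).

Section Wirtinger.
Variable R : realType.
Local Notation C := R[i].
Local Notation B := (bipoly R).
Implicit Types f g : B.

Definition bicst (k : C) : B := k%:P%:P.
Definition zvar : B := bx R + bicst 'i%C * by_ R.
Definition wvar : B := bx R - bicst 'i%C * by_ R.

Definition dx f : B := map_poly (@deriv C) f.
(* d_x + s d_y: twice d_w for s = i, and twice d_z for s = -i. *)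
Definition wirtinger (s : C) f : B := dx f + bicst s * f^`().

Lemma bicst0 : bicst 0 = 0.
Proof. by rewrite /bicst !polyC0. Qed.
Lemma bicst1 : bicst 1 = 1.
Proof. by rewrite /bicst !polyC1. Qed.
Lemma bicstM : {morph bicst : k l / k * l}.
Proof. by move=> k l; rewrite /bicst !polyCM. Qed.
Lemma bicstD : {morph bicst : k l / k + l}.
Proof. by move=> k l; rewrite /bicst !polyCD. Qed.
Lemma bicstN : {morph bicst : k / - k}.
Proof. by move=> k; rewrite /bicst !polyCN. Qed.

Lemma dxM f g : dx (f * g) = dx f * g + f * dx g.
Proof.
apply/polyP => j; rewrite coefD !coefM coef_map coefM (raddf_sum (@deriv C))/=.
rewrite -big_split/=.
by apply: eq_bigr => i _; rewrite derivM !coef_map.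
Qed.

Lemma dxD f g : dx (f + g) = dx f + dx g.
Proof. exact: raddfD. Qed.

Lemma wirtingerM s f g : wirtinger s (f * g) = wirtinger s f * g + f * wirtinger s g.
Proof. by rewrite /wirtinger dxM derivM; ring. Qed.

Lemma wirtingerD s f g : wirtinger s (f + g) = wirtinger s f + wirtinger s g.
Proof. by rewrite /wirtinger dxD derivD; ring. Qed.

Lemma dx_cst k : dx (bicst k) = 0.
Proof. by rewrite /dx map_polyC/= derivC. Qed.

Lemma wirtinger_cst s k : wirtinger s (bicst k) = 0.
Proof. by rewrite /wirtinger dx_cst derivC mulr0 addr0. Qed.

Lemma dx_y : dx (by_ R) = 0.
Proof.
apply/polyP => j; rewrite coef_map coefX coef0; case: (j == 1)%N => /=.
  by rewrite -polyC1 derivC.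
exact: linear0.
Qed.

(** For [s] and [t] among [i] and [-i] the constant is 0 or 2: each of the two operators kills one
    of z, w and sends the other to 2. *)
Lemma wirtinger_linear s t :
  wirtinger s (bx R + bicst t * by_ R) = bicst (1 + s * t).
Proof.
rewrite wirtingerD wirtingerM wirtinger_cst mul0r add0r /wirtinger dx_y add0r.
rewrite /dx /bx map_polyC/= derivX derivC mulr0 addr0 /by_ derivX mulr1.
by rewrite bicstD bicstM mulrC.
Qed.

Lemma wirtingerX s f k n : wirtinger s f = bicst k ->
  wirtinger s (f ^+ n) = bicst (n%:R * k) * f ^+ n.-1.
Proof.
move=> df; elim: n => [|n IHn].
  by rewrite expr0 -bicst1 wirtinger_cst mulr0n mul0r bicst0 mul0r.
rewrite exprS wirtingerM IHn df mulrCA -exprS; case: n {IHn} => [|n] /=.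
  by rewrite [_ * k]mul0r bicst0 mul0r addr0 [_ * k]mul1r.
by rewrite -mulrDl -bicstD [n.+2%:R]mulrSr mulrDl mul1r [k + _]addrC.
Qed.

(** The mixed terms of the product of the two first-order operators cancel because the partial
    derivatives commute, and [-i^2 = 1]. *)
Lemma lap_wirtinger f : lap f = wirtinger 'i%C (wirtinger (- 'i%C) f).
Proof.
have dxdy : dx f^`() = (dx f)^`().
  by apply/polyP => j; rewrite coef_deriv !coef_map coef_deriv raddfMn.
rewrite /wirtinger dxD derivD dxM dx_cst mul0r add0r.
rewrite derivM derivC mul0r add0r dxdy /lap.
have -> : map_poly (fun c : {poly C} => c^`(2)) f = dx (dx f).
  by apply/polyP => j; rewrite !coef_map.
have -> : f^`(2) = f^`()^`() by [].
rewrite bicstN; set ii := bicst 'i%C.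
have ii2 : ii * ii = - 1 by rewrite /ii -bicstM -expr2 sqr_i bicstN bicst1.
by ring: ii2.
Qed.

Lemma wirtinger_zw (s : C) a b k l :
  wirtinger s zvar = bicst k -> wirtinger s wvar = bicst l ->
  wirtinger s (zvar ^+ a * wvar ^+ b) =
  bicst (a%:R * k) * zvar ^+ a.-1 * wvar ^+ b +
  bicst (b%:R * l) * zvar ^+ a * wvar ^+ b.-1.
Proof.
by move=> dz dw; rewrite wirtingerM (wirtingerX _ dz) (wirtingerX _ dw); ring.
Qed.

Lemma wirtinger_i_zw a b :
  wirtinger 'i%C (zvar ^+ a * wvar ^+ b) =
  bicst (2 * b%:R) * (zvar ^+ a * wvar ^+ b.-1).
Proof.
rewrite (@wirtinger_zw _ a b 0 2).
- by rewrite mulr0 bicst0 !mul0r add0r mulrA [2 * _]mulrC.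
- by rewrite wirtinger_linear -expr2 sqr_i subrr.
- by rewrite /wvar -mulNr -bicstN wirtinger_linear mulrN -expr2 sqr_i opprK.
Qed.

Lemma wirtinger_Ni_zw a b :
  wirtinger (- 'i%C) (zvar ^+ a * wvar ^+ b) =
  bicst (2 * a%:R) * (zvar ^+ a.-1 * wvar ^+ b).
Proof.
rewrite (@wirtinger_zw _ a b 2 0).
- by rewrite mulr0 bicst0 !mul0r addr0 mulrA [2 * _]mulrC.
- by rewrite wirtinger_linear mulNr -expr2 sqr_i opprK.
- by rewrite /wvar -mulNr -bicstN wirtinger_linear mulrNN -expr2 sqr_i subrr.
Qed.

Lemma wirtingerZ s k f : wirtinger s (bicst k * f) = bicst k * wirtinger s f.
Proof. by rewrite wirtingerM wirtinger_cst mul0r add0r. Qed.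

Lemma lap_zw k a b : lap (bicst k * (zvar ^+ a * wvar ^+ b)) =
  bicst (4 * a%:R * b%:R * k) * (zvar ^+ a.-1 * wvar ^+ b.-1).
Proof.
rewrite lap_wirtinger !(wirtingerZ, wirtinger_Ni_zw, wirtinger_i_zw) !mulrA -!bicstM.
by congr (bicst _ * _ * _); ring.
Qed.

Lemma lapD f g : lap (f + g) = lap f + lap g.
Proof. by rewrite !lap_wirtinger !wirtingerD. Qed.

Lemma lap0 : lap (0 : B) = 0.
Proof. by apply: (addrI (lap 0)); rewrite -lapD !addr0. Qed.

End Wirtinger.

(** * The Gaussian functional on polynomials *)

Section GaussianFunctional.
Variable R : realType.
Local Notation C := R[i].
Local Notation B := (bipoly R).
Local Notation mu := (@lebesgue_measure R).
Implicit Types f g : B.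

Definition cmoment k : C := (gmoment R k)%:C%C.

Lemma cmoment_rec k : cmoment k.+1 *+ 2 = k%:R * cmoment k.-1.
Proof. by rewrite /cmoment -rmorphMn gmoment_rec rmorphM rmorph_nat. Qed.

(** The Gaussian integral over the plane, taken formally: moments in x on every coefficient, then
    moments in y. [integral_bieval] links it to the Lebesgue integral. *)
Definition gaussL f : C := umbral cmoment (map_poly (umbral cmoment) f).

Lemma gaussLD f g : gaussL (f + g) = gaussL f + gaussL g.
Proof. by rewrite /gaussL raddfD umbralD. Qed.

Lemma gaussL0 : gaussL 0 = 0.
Proof. by rewrite /gaussL raddf0 umbral0. Qed.

Lemma gaussLZ k f : gaussL (bicst k * f) = k * gaussL f.
Proof.
rewrite /gaussL -umbralZ; congr umbral; apply/polyP => j.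
by rewrite coefZ !coef_map/= coefCM mul_polyC umbralZ.
Qed.

Lemma gaussL_x f : gaussL (bx R * f) *+ 2 = gaussL (dx f).
Proof.
rewrite /gaussL -raddfMn/=; congr umbral; apply/polyP => j.
by rewrite coefMn !coef_map/= /bx coefCM (umbral_mulX _ cmoment_rec).
Qed.

Lemma gaussL_y f : gaussL (by_ R * f) *+ 2 = gaussL f^`().
Proof.
rewrite /gaussL.
have -> : map_poly (umbral cmoment) (by_ R * f) =
          'X * map_poly (umbral cmoment) f.
  apply/polyP => j; rewrite coef_map/= !coefXM.
  by case: (j == 0)%N; rewrite ?coef_map// umbral0.
rewrite (umbral_mulX _ cmoment_rec); congr umbral; apply/polyP => j.
by rewrite coef_deriv !coef_map/= coef_deriv raddfMn.
Qed.

Lemma gaussL_wirtinger s f :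
  gaussL ((bx R + bicst s * by_ R) * f) *+ 2 = gaussL (wirtinger s f).
Proof.
rewrite mulrDl gaussLD mulrnDl gaussL_x -mulrA gaussLZ -mulrnAr gaussL_y.
by rewrite gaussLD gaussLZ.
Qed.

(** Integration by parts trades a factor z for half the operator with [s = i], that is for the
    derivative in w. *)
Lemma gaussL_zS a b : gaussL (zvar R ^+ a.+1 * wvar R ^+ b) =
  b%:R * gaussL (zvar R ^+ a * wvar R ^+ b.-1).
Proof.
have /(congr1 (fun k : C => k / 2)) :=
  gaussL_wirtinger 'i%C (zvar R ^+ a * wvar R ^+ b).
rewrite -[gaussL _ *+ 2]mulr_natr mulfK ?pnatr_eq0// mulrA -exprS => ->.
by rewrite wirtinger_i_zw gaussLZ; field.
Qed.

Lemma gaussL_wS a b : gaussL (zvar R ^+ a * wvar R ^+ b.+1) =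
  a%:R * gaussL (zvar R ^+ a.-1 * wvar R ^+ b).
Proof.
have /(congr1 (fun k : C => k / 2)) :=
  gaussL_wirtinger (- 'i%C) (zvar R ^+ a * wvar R ^+ b).
rewrite -[gaussL _ *+ 2]mulr_natr mulfK ?pnatr_eq0// bicstN mulNr mulrCA -exprS => ->.
by rewrite wirtinger_Ni_zw gaussLZ; field.
Qed.

(** The two recurrences lower both exponents together; if they differ, one reaches 0 first and
    supplies a factor 0. *)
Lemma gaussL_zw a b : gaussL (zvar R ^+ a * wvar R ^+ b) =
  if a == b then a`!%:R * cmoment 0 ^+ 2 else 0.
Proof.
elim: b a => [|b IHb] [|a] /=.
- rewrite !expr0 mulr1 fact0 mul1r /gaussL -[1]/(1%:P) map_polyC/= umbral1.
  by rewrite -[_%:P]mulr1 mul_polyC umbralZ umbral1 expr2.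
- by rewrite gaussL_zS mul0r.
- by rewrite gaussL_wS mul0r.
rewrite gaussL_zS IHb eqSS; case: eqP => [->|_]; last by rewrite mulr0.
by rewrite mulrA -natrM -factS.
Qed.

Lemma bievalE f x y : bieval f x y =
  \sum_(j < size f) \sum_(i < size f`_j) f`_j`_i * ((x%:C)%C ^+ i * (y%:C)%C ^+ j).
Proof.
rewrite /bieval (@horner_coef_wide _ (size f)) ?size_poly//.
apply: eq_bigr => j _; rewrite (coef_map (horner_eval _))/= /horner_eval.
by rewrite horner_coef mulr_suml; apply: eq_bigr => i _; rewrite mulrA.
Qed.

Lemma gaussLE f : gaussL f =
  \sum_(j < size f) \sum_(i < size f`_j) f`_j`_i * (cmoment i * cmoment j).
Proof.
rewrite /gaussL (@umbralE _ _ (size f)) ?size_poly//.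
apply: eq_bigr => j _; rewrite coef_map/= /umbral.
by rewrite mulr_suml; apply: eq_bigr => i _; rewrite mulrA.
Qed.

Lemma Re_sum (I : Type) (r : seq I) (P : pred I) (F : I -> C) :
  complex.Re (\sum_(i <- r | P i) F i) = \sum_(i <- r | P i) complex.Re (F i).
Proof.
by apply: (big_morph (@complex.Re R) (id1 := 0) (op1 := +%R)) => // -[a b] [c d].
Qed.

Lemma Re_mulR (k : C) (r : R) : complex.Re (k * (r%:C)%C) = complex.Re k * r.
Proof. by case: k => a b /=; rewrite mulr0 subr0. Qed.

Local Open Scope ereal_scope.

(** Expanding [f] into monomials reduces the claim to products of one-dimensional moments. Real
    parts appear because the integral is that of a real-valued function. *)
Lemma integral_bieval f (h : R * R -> \bar R) :
  (forall z, h z = (complex.Re (bieval f z.1 z.2) *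
                    expR (- (z.1 ^+ 2 + z.2 ^+ 2)))%:E) ->
  \int[mu \x mu]_z h z = (complex.Re (gaussL f))%:E.
Proof.
move=> hE.
pose t (j i : nat) (z : R * R) : \bar R :=
  (gauss_monomial i z.1 * gauss_monomial j z.2)%:E.
have tI j i := @integral_gauss_monomial2 R i j (t j i) (fun=> erefl).
have -> : h = fun z => \sum_(j < size f) \sum_(i < size f`_j)
   (complex.Re f`_j`_i)%:E * t j i z.
  apply/funext => -[x y]; rewrite hE /t/= bievalE Re_sum mulr_suml -sumEFin.
  apply: eq_bigr => j _; rewrite Re_sum mulr_suml -sumEFin.
  apply: eq_bigr => i _; rewrite -!rmorphXn -rmorphM Re_mulR -EFinM; congr EFin.
  by rewrite /gauss_monomial /gauss_fun opprD expRD; ring.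
rewrite integral_sum//=; last first.
  move=> j; apply: integrable_sum => // i _.
  exact: (integrableZl measurableT _ (tI _ _).1).
rewrite gaussLE Re_sum -sumEFin; apply: eq_bigr => j _.
rewrite integral_sum//=; last first.
  by move=> i; exact: (integrableZl measurableT _ (tI _ _).1).
rewrite Re_sum -sumEFin; apply: eq_bigr => i _.
rewrite integralZl//; last exact: (tI _ _).1.
by rewrite (tI j i).2 -rmorphM Re_mulR -EFinM.
Qed.

End GaussianFunctional.

(** * The Fischer norm in terms of coefficients in z and w *)

Section NormFormula.
Variable R : realType.
Local Notation C := R[i].
Local Notation B := (bipoly R).
Implicit Types f g : B.

Definition biconj f : B := map_poly (map_poly (@conjc R)) f.

Lemma biconjD f g : biconj (f + g) = biconj f + biconj g.
Proof. exact: rmorphD. Qed.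

Lemma biconjM f g : biconj (f * g) = biconj f * biconj g.
Proof. exact: rmorphM. Qed.

Lemma biconjXn f n : biconj (f ^+ n) = biconj f ^+ n.
Proof. exact: rmorphXn. Qed.

Lemma biconj_cst k : biconj (bicst k) = bicst k^*%C.
Proof. by rewrite /biconj /bicst map_polyC/= map_polyC. Qed.

Lemma conjc_i : ('i%C : C)^*%C = - 'i%C.
Proof. by apply/eqP; rewrite eq_complex/= oppr0 !eqxx. Qed.

Lemma biconj_z : biconj (zvar R) = wvar R.
Proof.
rewrite /zvar biconjD biconjM biconj_cst conjc_i /biconj /bx /by_ map_polyX map_polyC/=.
by rewrite map_polyX /wvar -mulNr -bicstN.
Qed.

Lemma biconj_w : biconj (wvar R) = zvar R.
Proof.
rewrite /wvar -mulNr -bicstN biconjD biconjM biconj_cst -conjc_i conjcK.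
rewrite /biconj /bx /by_ map_polyX map_polyC/=.
by rewrite map_polyX.
Qed.

Lemma bievalM f g x y : bieval (f * g) x y = bieval f x y * bieval g x y.
Proof.
rewrite /bieval -hornerM; congr (_.[_]).
exact: (rmorphM (map_poly (horner_eval (x%:C)%C))).
Qed.

Lemma bieval_conj f x y : bieval (biconj f) x y = (bieval f x y)^*%C.
Proof.
rewrite /bieval -horner_map/= oppr0; congr (_.[_]).
apply/polyP => j.
rewrite coef_map !(coef_map (horner_eval (x%:C)%C)) coef_map/= /horner_eval.
by rewrite -horner_map/= oppr0.
Qed.

Lemma mul_conjc (z : C) : z * z^*%C = (sqmod z)%:C%C.
Proof.
case: z => a b; apply/eqP; rewrite eq_complex/= /sqmod /=; apply/andP; split.
  by apply/eqP; ring.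
by apply/eqP; ring.
Qed.

(** At real points [biconj f] takes the conjugate values of [f], so the squared modulus is itself a
    polynomial to which [gaussL] applies. *)
Lemma fnormE f : fnorm f = Num.sqrt (complex.Re (gaussL (f * biconj f))).
Proof.
rewrite /fnorm (@integral_bieval _ (f * biconj f)) => [//|[x y]].
by rewrite bievalM bieval_conj mul_conjc.
Qed.

(** The homogenisation of [g] in degree [n]; coefficients of index above [n] are discarded, whence
    the size bounds in later statements. *)
Definition zwform n (g : {poly C}) : B :=
  \sum_(k < n.+1) bicst g`_k * (zvar R ^+ k * wvar R ^+ (n - k)).

Lemma biconj_zwform n (c : {poly C}) : biconj (zwform n c) =
  \sum_(k < n.+1) bicst (c`_k)^*%C * (wvar R ^+ k * zvar R ^+ (n - k)).
Proof.
rewrite /zwform (big_morph biconj biconjD (id1 := 0)); last exact: rmorph0.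
apply: eq_bigr => k _.
by rewrite !(biconjM, biconj_cst, biconjXn, biconj_z, biconj_w).
Qed.

Lemma gaussL_sum I (r : seq I) (P : pred I) (F : I -> B) :
  gaussL (\sum_(i <- r | P i) F i) = \sum_(i <- r | P i) gaussL (F i).
Proof. exact: (big_morph (@gaussL R) (@gaussLD R) (@gaussL0 R)). Qed.

(** Conjugation exchanges z and w, so by [gaussL_zw] only the diagonal terms survive. Each has
    weight [n!], whatever [k] is, so the norm is a multiple of the plain l^2 norm. *)
Lemma gaussL_zwform n (c : {poly C}) : gaussL (zwform n c * biconj (zwform n c)) =
  (gmoment R 0 ^+ 2 * n`!%:R * \sum_(k < n.+1) sqmod c`_k)%:C%C.
Proof.
rewrite biconj_zwform /zwform mulr_suml gaussL_sum mulr_sumr rmorph_sum.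
apply: eq_bigr => k _; rewrite mulr_sumr gaussL_sum (bigD1 k)//= big1 => [|l lk].
  rewrite addr0 (_ : _ * _ = bicst (c`_k * (c`_k)^*%C) * (zvar R ^+ n * wvar R ^+ n)).
    rewrite gaussLZ gaussL_zw eqxx mul_conjc /cmoment.
    rewrite -(rmorph_nat (real_complex R)) -(rmorphXn (real_complex R)).
    by rewrite -!(rmorphM (real_complex R)) mulrC -mulrA [n`!%:R * _]mulrC mulrA.
  have Xn (v : B) : v ^+ n = v ^+ k * v ^+ (n - k).
    by rewrite -exprD subnKC// leq_ord.
  by rewrite bicstM !Xn; ring.
rewrite (_ : _ * _ = bicst (c`_k * (c`_l)^*%C) *
    (zvar R ^+ (k + (n - l)) * wvar R ^+ ((n - k) + l))).
  rewrite gaussLZ gaussL_zw ifN ?mulr0//; apply: contra_neq lk => kl.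
  by apply/val_inj => /=; have := leq_ord k; have := leq_ord l; lia.
by rewrite bicstM !exprD; ring.
Qed.

Lemma fnorm_zwform n (c : {poly C}) : fnorm (zwform n c) =
  Num.sqrt (gmoment R 0 ^+ 2 * n`!%:R * \sum_(k < n.+1) sqmod c`_k).
Proof. by rewrite fnormE gaussL_zwform. Qed.

Lemma sqmod_ge0 (z : C) : 0 <= sqmod z.
Proof. by rewrite addr_ge0 ?sqr_ge0. Qed.

Lemma sqmod_eq0 (z : C) : (sqmod z == 0) = (z == 0).
Proof. by rewrite paddr_eq0 ?sqr_ge0// !sqrf_eq0 eq_complex. Qed.

(** Linear independence is read off the norm formula: a vanishing sum of squared moduli has
    vanishing terms. *)
Lemma zwform_eq0 n (c : {poly C}) : zwform n c = 0 -> forall k, (k <= n)%N -> c`_k = 0.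
Proof.
move=> c0 k kn; have := gaussL_zwform n c; rewrite c0 mul0r gaussL0 => /esym/eqP.
rewrite eq_complex/= eqxx andbT !mulf_eq0 gt_eqF ?gmoment0_gt0//.
rewrite pnatr_eq0 -leqn0 leqNgt fact_gt0/= psumr_eq0 => [/allP|i _]; last first.
  exact: sqmod_ge0.
move=> /(_ (Ordinal (kn : k < n.+1)%N)).
by rewrite mem_index_enum sqmod_eq0 => /(_ isT)/eqP.
Qed.

End NormFormula.

(** * Forms in z and w *)

Section HomogeneousForms.
Variable R : realType.
Local Notation C := R[i].
Local Notation B := (bipoly R).
Implicit Types (f : B) (c : {poly C}).

Lemma zwformD n c d : zwform n (c + d) = zwform n c + zwform n d :> B.
Proof.
by rewrite -big_split/=; apply: eq_bigr => k _; rewrite coefD bicstD mulrDl.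
Qed.

Lemma zwformZ n k c : zwform n (k *: c) = bicst k * zwform n c :> B.
Proof.
by rewrite mulr_sumr; apply: eq_bigr => i _; rewrite coefZ bicstM mulrA.
Qed.

Lemma zwformB n c d : zwform n (c - d) = zwform n c - zwform n d :> B.
Proof. by rewrite -scaleN1r zwformD zwformZ bicstN mulN1r. Qed.

Lemma zwform0 n : zwform n 0 = 0 :> B.
Proof. by rewrite -(scale0r 0) zwformZ bicst0 mul0r. Qed.

Lemma zwform_mulz n c : zvar R * zwform n c = zwform n.+1 ('X * c).
Proof.
rewrite [RHS]big_ord_recl coefXM/= bicst0 mul0r add0r mulr_sumr.
apply: eq_bigr => k _; rewrite coefXM/= exprS; ring.
Qed.

Lemma zwform_mulw n c : (size c <= n.+1)%N ->
  wvar R * zwform n c = zwform n.+1 c.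
Proof.
move=> sc; rewrite [RHS]big_ord_recr/= nth_default// bicst0 mul0r addr0 mulr_sumr.
apply: eq_bigr => k _; rewrite subSn ?leq_ord// exprS; ring.
Qed.

(** Dehomogenised by w = 1, the linear form z - tw is [X - t]. *)
Lemma zwform_mul_factor n c t : (size c <= n.+1)%N ->
  (zvar R - bicst t * wvar R) * zwform n c = zwform n.+1 (('X - t%:P) * c).
Proof.
move=> sc; rewrite mulrBl zwform_mulz -mulrA zwform_mulw// -zwformZ -zwformB.
by rewrite mulrBl mul_polyC.
Qed.

Lemma zwform_mul_prod n c (t : nat -> C) N : (size c <= n.+1)%N ->
  \prod_(j < N) (zvar R - bicst (t j) * wvar R) * zwform n c =
  zwform (n + N) (\prod_(j < N) ('X - (t j)%:P) * c).
Proof.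
move=> sc; elim: N => [|N IHN]; first by rewrite !big_ord0 !mul1r addn0.
rewrite !big_ord_recr/= mulrAC IHN mulrC addnS zwform_mul_factor.
  by rewrite mulrA [_ * \prod_(_ < N) _]mulrC.
rewrite (leq_trans (size_polyMleq _ _))//.
rewrite -(big_mkord xpredT (fun j => 'X - (t j)%:P)) size_prod_XsubC size_iota; lia.
Qed.

Definition is_zwform n f := exists2 c : {poly C}, (size c <= n.+1)%N & f = zwform n c.

Lemma is_zwform0 n : is_zwform n 0.
Proof. by exists 0; rewrite ?size_poly0// zwform0. Qed.

Lemma is_zwformD n f g : is_zwform n f -> is_zwform n g -> is_zwform n (f + g).
Proof.
move=> [c sc ->] [d sd ->]; exists (c + d); last by rewrite zwformD.
by rewrite (leq_trans (size_polyD _ _))// geq_max sc.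
Qed.

Lemma is_zwformZ n k f : is_zwform n f -> is_zwform n (bicst k * f).
Proof.
move=> [c sc ->]; exists (k *: c); last by rewrite zwformZ.
by rewrite (leq_trans (size_scale_leq _ _)).
Qed.

Lemma is_zwform_mulz n f : is_zwform n f -> is_zwform n.+1 (zvar R * f).
Proof.
move=> [c sc ->]; exists ('X * c); last by rewrite zwform_mulz.
by rewrite (leq_trans (size_polyMleq _ _))// size_polyX.
Qed.

Lemma is_zwform_mulw n f : is_zwform n f -> is_zwform n.+1 (wvar R * f).
Proof.
move=> [c sc ->]; exists c; first exact: leqW.
by rewrite zwform_mulw.
Qed.

Lemma bicst_half : bicst 2^-1 + bicst 2^-1 = 1 :> B.
Proof. by rewrite -bicstD -[2^-1]mul1r -splitr bicst1. Qed.

Lemma bicst_i2 : bicst 'i%C * bicst 'i%C = - 1 :> B.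
Proof. by rewrite -bicstM -expr2 sqr_i bicstN bicst1. Qed.

Lemma bxE : bx R = bicst 2^-1 * zvar R + bicst 2^-1 * wvar R.
Proof. by rewrite /zvar /wvar; ring: bicst_half. Qed.

Lemma by_E : by_ R = bicst (- 'i%C / 2) * zvar R + bicst ('i%C / 2) * wvar R.
Proof. by rewrite /zvar /wvar !bicstM bicstN; ring: bicst_half bicst_i2. Qed.

Lemma is_zwform_mulx n f : is_zwform n f -> is_zwform n.+1 (bx R * f).
Proof.
move=> hf; rewrite bxE mulrDl -!mulrA; apply: is_zwformD; apply: is_zwformZ.
  exact: is_zwform_mulz.
exact: is_zwform_mulw.
Qed.

Lemma is_zwform_muly n f : is_zwform n f -> is_zwform n.+1 (by_ R * f).
Proof.
move=> hf; rewrite by_E mulrDl -!mulrA; apply: is_zwformD; apply: is_zwformZ.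
  exact: is_zwform_mulz.
exact: is_zwform_mulw.
Qed.

Lemma is_zwform_xy i j : is_zwform (i + j) (bx R ^+ i * by_ R ^+ j).
Proof.
elim: i => [|i IHi].
  rewrite expr0 mul1r add0n; elim: j => [|j IHj].
    exists 1; first by rewrite size_poly1.
    by rewrite /zwform big_ord1 coef1 subnn !expr0 /= bicst1 !mulr1.
  by rewrite exprS; exact: is_zwform_muly.
by rewrite addSn exprS -mulrA; exact: is_zwform_mulx.
Qed.

Lemma bipolyE f : f =
  \sum_(j < size f) \sum_(i < size f`_j) bicst f`_j`_i * (bx R ^+ i * by_ R ^+ j).
Proof.
rewrite -[LHS]coefK poly_def; apply: eq_bigr => j _.
rewrite -mul_polyC -{1}[f`_j]coefK poly_def rmorph_sum/= mulr_suml.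
apply: eq_bigr => i _.
by rewrite -mul_polyC rmorphM rmorphXn/= -mulrA.
Qed.

(** Each of x and y is a linear combination of z and w, so the property passes to monomials by
    induction, and then to sums. *)
Lemma homog_is_zwform n f : homog n f -> is_zwform n f.
Proof.
move=> hf; rewrite [f]bipolyE; apply: big_ind => [||j _].
- exact: is_zwform0.
- exact: is_zwformD.
apply: big_ind => [||i _].
- exact: is_zwform0.
- exact: is_zwformD.
have [->|/hf <-] := eqVneq (f`_j`_i) 0.
  by rewrite bicst0 mul0r; exact: is_zwform0.
exact/is_zwformZ/is_zwform_xy.
Qed.

Lemma homog0 n : homog n (0 : B).
Proof. by move=> i j; rewrite !coef0 eqxx. Qed.

Lemma homogD n f g : homog n f -> homog n g -> homog n (f + g).
Proof.
move=> hf hg i j; rewrite !coefD.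
have [->|/hf//] := eqVneq (f`_j`_i) 0.
by rewrite add0r => /hg.
Qed.

Lemma homog_sum n I (r : seq I) (P : pred I) (F : I -> B) :
  (forall i, P i -> homog n (F i)) -> homog n (\sum_(i <- r | P i) F i).
Proof.
by move=> hF; apply: big_ind => //; [exact: homog0|exact: homogD].
Qed.

Lemma homogM n m f g : homog n f -> homog m g -> homog (n + m) (f * g).
Proof.
move=> hf hg i j; rewrite coefM coef_sum => s_neq0.
have [a _] : exists2 a : 'I_j.+1, true & (f`_a * g`_(j - a))`_i != 0.
  apply/exists_inP; apply: contra_neqT s_neq0 => /exists_inPn h.
  by apply: big1 => a _; apply/eqP; rewrite -[_ == _]negbK h.
rewrite coefM => s_neq0'.
have [b _] : exists2 b : 'I_i.+1, true & f`_a`_b * g`_(j - a)`_(i - b) != 0.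
  apply/exists_inP; apply: contra_neqT s_neq0' => /exists_inPn h.
  by apply: big1 => b _; apply/eqP; rewrite -[_ == _]negbK h.
rewrite mulf_eq0 negb_or => /andP[/hf <- /hg <-].
by have := leq_ord a; have := leq_ord b; lia.
Qed.

Lemma homog_cst (k : C) : homog 0 (bicst k).
Proof.
move=> i j; rewrite /bicst !coefC; case: j => [|j] /=; last by rewrite coef0 eqxx.
by rewrite coefC; case: i => [|i] //=; rewrite eqxx.
Qed.

Lemma homogZ n (k : C) f : homog n f -> homog n (bicst k * f).
Proof. by move=> hf; rewrite -[n]add0n; apply: homogM => //; exact: homog_cst. Qed.

Lemma homogX n f k : homog n f -> homog (n * k) (f ^+ k).
Proof.
move=> hf; elim: k => [|k IHk].
  by rewrite muln0 expr0 -bicst1; exact: homog_cst.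
by rewrite exprS mulnS; exact: homogM.
Qed.

Lemma homog_x : homog 1 (bx R).
Proof.
move=> i j; rewrite /bx coefC; case: j => [|j] /=; last by rewrite coef0 eqxx.
by rewrite coefX; case: (eqVneq i 1%N) => [->//|_]; rewrite eqxx.
Qed.

Lemma homog_y : homog 1 (by_ R).
Proof.
move=> i j; rewrite /by_ coefX; case: (eqVneq j 1%N) => [->|_] /=; last first.
  by rewrite coef0 eqxx.
by rewrite coef1; case: i => [|i] //=; rewrite eqxx.
Qed.

Lemma homog_zwform n c : homog n (zwform n c).
Proof.
apply: homog_sum => k _; apply: homogZ.
have nE : (1 * k + 1 * (n - k) = n)%N by have := leq_ord k; lia.
rewrite -[X in homog X _]nE.
apply: homogM; apply: homogX; rewrite /wvar -?mulNr -?bicstN; apply: homogD;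
  by [exact: homog_x|apply: homogZ; exact: homog_y].
Qed.

End HomogeneousForms.

(** * The linear system of the Fischer operator *)

(* Otherwise unification unfolds [bicst k] when looking for 0, 1 or products. *)
Local Opaque bicst.

Section FischerOperator.
Variable R : realType.
Local Notation C := R[i].
Local Notation B := (bipoly R).
Implicit Types (f : B) (c : {poly C}).

Lemma lap_zwform n c : lap (zwform n.+2 c) =
  zwform n (\poly_(k < n.+1) (4 * (k.+1 * (n - k).+1)%:R * c`_k.+1)).
Proof.
rewrite /zwform (big_morph _ (@lapD R) (@lap0 R)).
under eq_bigr => k _ do rewrite lap_zw.
(* The two extreme monomials, pure powers of w and of z, are harmonic. *)
rewrite big_ord_recl/= mulr0 !mul0r add0r.
rewrite big_ord_recr/= subnn mulr0 !mul0r addr0.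
apply: eq_bigr => k _; rewrite coef_poly ltn_ord !subSS subSn ?leq_ord//=.
by rewrite natrM mulrA.
Qed.

(** Each Laplacian lowers both exponents by one and multiplies by 4 times their product; over [p]
    steps the factors gather into falling factorials. *)
Lemma iter_lap_zwform p n c : iter p (@lap R) (zwform (n + p.*2) c) =
  zwform n (\poly_(k < n.+1)
    (4 ^+ p * ((k + p) ^_ p * (n - k + p) ^_ p)%:R * c`_(k + p))).
Proof.
elim: p c => [|p IHp] c.
  rewrite addn0 /=; apply: eq_bigr => k _.
  by rewrite coef_poly ltn_ord !addn0 !ffactn0 muln1 expr0 mulr1n mulr1 mul1r.
rewrite iterSr doubleS !addnS lap_zwform IHp; apply: eq_bigr => k _.
rewrite !coef_poly !ltn_ord ifT; last by have := ltn_ord k; lia.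
congr (bicst _ * _); rewrite !addnS !ffactSS !mulrA exprSr -!mulrA.
have -> : (n + p.*2 - (k + p) = n - k + p)%N by have := ltn_ord k; lia.
congr (_ * _); rewrite mulrCA; congr (_ * _); rewrite !mulrA -!natrM.
by congr (_%:R * _); lia.
Qed.

(** Index 0 stands for the factor y of P_a: z - w = 2iy, so its node is 1, and the row of ones in
    the matrix becomes a row of powers like the others. *)
Definition node (a : nat -> R) j : C := if j == 0%N then 1 else Acoef (a j).

Lemma subr_i_neq0 (a : R) : (a%:C)%C - 'i%C != 0 :> C.
Proof. by rewrite eq_complex/= sub0r oppr_eq0 oner_eq0 andbF. Qed.

Lemma i_neq0 : 'i%C != 0 :> C.
Proof. by rewrite eq_complex/= oner_eq0 andbF. Qed.

Lemma subr1_Acoef (a : R) : 1 - Acoef a = - 2 * 'i%C / ((a%:C)%C - 'i%C).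
Proof. by have := subr_i_neq0 a; rewrite /Acoef => a0; field. Qed.

Lemma subr1_Acoef_neq0 (a : R) : 1 - Acoef a != 0.
Proof.
by rewrite subr1_Acoef !mulf_neq0 ?invr_eq0 ?subr_i_neq0 ?i_neq0//.
Qed.

(** The left side is (1 - A)x + i(1 + A)y, and A is chosen so that i(1 + A) = -(1 - A)a. *)
Lemma zw_factor (a : R) : zvar R - bicst (Acoef a) * wvar R =
  bicst (1 - Acoef a) * (bx R - bicst (a%:C)%C * by_ R).
Proof.
have Aa : 'i%C * (1 + Acoef a) = - ((1 - Acoef a) * (a%:C)%C).
  by have := subr_i_neq0 a; rewrite /Acoef => a0; field.
move: (Acoef a) Aa => k /(congr1 (@bicst R)).
rewrite bicstN !bicstM !bicstD !bicstN bicst1 /zvar /wvar => e.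
transitivity ((1 - bicst k) * bx R + bicst 'i%C * (1 + bicst k) * by_ R); first by ring.
by rewrite e; ring.
Qed.

(** The parameter is recovered by 2i / (1 - A(a)) = i - a. *)
Lemma Acoef_inj : injective (@Acoef R).
Proof.
move=> a b /(congr1 (fun k => 2 * 'i%C / (1 - k))).
rewrite !subr1_Acoef => e; apply: (@complexI R).
have i0 := i_neq0; have a0 := subr_i_neq0 a; have b0 := subr_i_neq0 b.
apply: (addIr (- 'i%C)).
have k (z : C) : z != 0 -> 2 * 'i%C / (- 2 * 'i%C / z) = - z.
  by move=> z0; field; rewrite z0 i0.
by move: e; rewrite !k// => /oppr_inj.
Qed.

Definition Pscale p (a : nat -> R) : C :=
  2 * 'i%C * \prod_(1 <= j < p.*2) (1 - Acoef (a j)).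

Lemma Pscale_neq0 p a : Pscale p a != 0.
Proof.
rewrite /Pscale !mulf_neq0 ?i_neq0 ?pnatr_eq0// prodf_seq_neq0.
by apply/allP => j _; exact: subr1_Acoef_neq0.
Qed.

Lemma zw_factor0 : zvar R - bicst 1 * wvar R = bicst (2 * 'i%C) * by_ R.
Proof.
have -> : 2 * 'i%C = 'i%C + 'i%C :> C by rewrite mulr2n mulrDl mul1r.
by rewrite bicst1 bicstD /zvar /wvar; ring.
Qed.

Lemma Pa_factor p a : (0 < p)%N ->
  \prod_(j < p.*2) (zvar R - bicst (node a j) * wvar R) =
  bicst (Pscale p a) * Pa p a.
Proof.
move=> p0; rewrite -(big_mkord xpredT (fun j => zvar R - bicst (node a j) * wvar R)).
rewrite big_ltn ?double_gt0// {1}/node/= zw_factor0.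
rewrite (eq_big_nat _ _ (F2 := fun j => bicst (1 - Acoef (a j)) *
  (bx R - bicst (a j)%:C%C * by_ R))); last first.
  by move=> [|j] // _; exact: zw_factor.
rewrite big_split/= -(big_morph _ (@bicstM R) (@bicst1 R)).
rewrite /Pscale /Pa (bicstM (2 * _)).
move: (bicst _) (bicst _) => u v.
by rewrite mulrACA.
Qed.

Definition nodal p a : {poly C} := \prod_(j < p.*2) ('X - (node a j)%:P).

Lemma Pa_zwform p a m c : (0 < p)%N -> (size c <= m.+1)%N ->
  Pa p a * zwform m c = zwform (m + p.*2) ((Pscale p a)^-1 *: (nodal p a * c)).
Proof.
move=> p0 sc; rewrite zwformZ -zwform_mul_prod// Pa_factor// mulrA mulrA -bicstM.
by rewrite mulVf ?Pscale_neq0// bicst1 mul1r.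
Qed.

(* The exponents k < p and k > m + p, i.e. those of the columns of M_{m,p,a}. *)
Definition badix m p i : nat := if (i < p)%N then i else (m + i + 1)%N.

Lemma MmatE m p a (j i : 'I_p.*2) : Mmat m p a j i = node a j ^+ badix m p i.
Proof.
rewrite mxE /node /badix; case: eqP => _; first by rewrite expr1n.
by case: ifP.
Qed.

(** The exponents up to [m + 2p] fall into three blocks: the first [p], the middle [m + 1] and the
    last [p]; [badix] enumerates the outer two. *)
Lemma sum_badix (V : zmodType) m p (F : nat -> V) :
  \sum_(k < (m + p.*2).+1) F k =
  \sum_(i < p.*2) F (badix m p i) + \sum_(t < m.+1) F (p + t)%N.
Proof.
rewrite -(big_mkord xpredT F) -(big_mkord xpredT (fun i => F (badix m p i))).
rewrite -(big_mkord xpredT (fun t => F (p + t)%N)).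
rewrite (@big_cat_nat _ _ _ p)//=; last by lia.
rewrite (@big_cat_nat _ _ _ (p + m.+1)%N p)//=; [|lia..].
rewrite [in RHS](@big_cat_nat _ _ _ p)//=; last by lia.
rewrite -addrA; congr (_ + _).
  by apply: eq_big_nat => i /andP[_ ip]; rewrite /badix ip.
rewrite addrC; congr (_ + _).
  rewrite big_addn (_ : _ - _ = p.*2)%N; last by lia.
  apply: eq_big_nat => i /andP[pi _]; rewrite /badix ltnNge pi/=.
  by congr F; lia.
rewrite -{1}[p]add0n big_addn addKn.
by apply: eq_bigr => t _; rewrite addnC.
Qed.

Definition goodsum m p c (x : C) : C := \sum_(t < m.+1) c`_(p + t) * x ^+ (p + t).

Lemma horner_badix m p c x : (size c <= (m + p.*2).+1)%N ->
  c.[x] = \sum_(i < p.*2) c`_(badix m p i) * x ^+ badix m p i + goodsum m p c x.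
Proof.
move=> sc; rewrite (horner_coef_wide _ sc).
by rewrite (sum_badix m p (fun k => c`_k * x ^+ k)).
Qed.

(** The link with the matrix: vanishing at the nodes is a linear system for the outer coefficients,
    with right-hand side given by the middle ones. *)
Lemma Mmat_mul m p a c (j : 'I_p.*2) : (size c <= (m + p.*2).+1)%N ->
  (Mmat m p a *m \col_i c`_(badix m p i)) j 0 = c.[node a j] - goodsum m p c (node a j).
Proof.
move=> sc; rewrite (horner_badix _ sc) addrK mxE; apply: eq_bigr => i _.
by rewrite MmatE mxE mulrC.
Qed.

(* The polynomial with coefficients b at the exponents badix m p i and s at the
   remaining exponents p, ..., p + m. *)
Definition assemble m p (b s : nat -> C) : {poly C} :=
  \poly_(k < (m + p.*2).+1)
    if (k < p)%N then b k else if (k <= m + p)%N then s (k - p)%N else b (k - m - 1)%N.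

Lemma assemble_bad m p b s i : (i < p.*2)%N -> (assemble m p b s)`_(badix m p i) = b i.
Proof.
rewrite /badix coef_poly => ip; case: (ltnP i p) => [lt_ip|le_pi].
  by rewrite lt_ip ifT//; lia.
rewrite ifT; last by lia.
rewrite ifF; last by lia.
rewrite ifF; last by lia.
by congr b; lia.
Qed.

Lemma assemble_good m p b s t : (t <= m)%N -> (assemble m p b s)`_(p + t) = s t.
Proof.
move=> tm; rewrite coef_poly ifT; last by lia.
rewrite ifF; last by lia.
rewrite ifT; last by lia.
by congr s; lia.
Qed.

(** * Distinctness of the nodes and divisibility by the nodal polynomial *)

Section Nodes.
Variables (p : nat) (a : nat -> R).
Hypothesis p_gt0 : (0 < p)%N.
Hypothesis a_inj : forall j k : nat, (1 <= j < p.*2)%N -> (1 <= k < p.*2)%N ->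
     a j = a k -> j = k.

Lemma node_inj j k : (j < p.*2)%N -> (k < p.*2)%N -> node a j = node a k -> j = k.
Proof.
have A1 x : Acoef x <> 1 :> C.
  by move=> e; have := subr1_Acoef_neq0 x; rewrite e subrr eqxx.
rewrite /node; case: j k => [|j] [|k] //= jp kp.
- by move=> /esym/A1.
- by move=> /A1.
- by move=> /Acoef_inj; apply: a_inj.
Qed.

Lemma nodal_root j : (j < p.*2)%N -> root (nodal p a) (node a j).
Proof.
move=> jp; rewrite /root horner_prod (bigD1 (Ordinal jp))//=.
by rewrite hornerXsubC subrr mul0r.
Qed.

Lemma size_nodal : size (nodal p a) = p.*2.+1.
Proof.
rewrite /nodal -(big_mkord xpredT (fun j => 'X - (node a j)%:P)).
by rewrite size_prod_XsubC size_iota subn0.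
Qed.

Lemma monic_nodal : nodal p a \is monic.
Proof. exact: monic_prod_XsubC. Qed.

(** Distinct roots can be divided out together, and the degree of the quotient follows since the
    nodal polynomial is monic. *)
Lemma nodal_dvd m c : (size c <= (m + p.*2).+1)%N ->
  (forall j, (j < p.*2)%N -> c.[node a j] = 0) ->
  exists2 h : {poly C}, (size h <= m.+1)%N & c = nodal p a * h.
Proof.
move=> sc c0.
have [||h ch] := @uniq_roots_prod_XsubC _ c [seq node a j | j <- iota 0 p.*2].
- apply/allP => x /mapP[j]; rewrite mem_iota add0n => /andP[_ jp] ->.
  by rewrite /root c0.
- rewrite uniq_rootsE map_inj_in_uniq ?iota_uniq// => j k.
  by rewrite !mem_iota !add0n /=; exact: node_inj.
have {}ch : c = h * nodal p a.
  rewrite ch /nodal -(big_mkord xpredT (fun j => 'X - (node a j)%:P)) big_map.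
  by rewrite /index_iota subn0.
exists h; last by rewrite mulrC.
have [->|h0] := eqVneq h 0; first by rewrite size_poly0.
move: sc; rewrite ch size_Mmonic ?monic_nodal// size_nodal; lia.
Qed.

End Nodes.

End FischerOperator.

(** * Determinant and weight bounds *)

Section DeterminantBounds.
Variable F : numDomainType.

Lemma norm_det_le n (A : 'M[F]_n) :
  (forall i j, `|A i j| <= 1) -> `|\det A| <= n`!%:R.
Proof.
move=> A1; apply: le_trans (ler_norm_sum _ _ _) _.
apply: (@le_trans _ _ (\sum_(s : 'S_n) 1)); last by rewrite sumr_const card_Sn.
apply: ler_sum => s _; rewrite normrM normrX normrN1 expr1n mul1r normr_prod.
by apply: prodr_ile1 => i _; rewrite normr_ge0 A1.
Qed.

Lemma norm_adjugate_le n (A : 'M[F]_n) i j :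
  (forall i j, `|A i j| <= 1) -> `|\adj A i j| <= n.-1`!%:R.
Proof.
move=> A1; rewrite mxE /cofactor normrM normrX normrN1 expr1n mul1r.
by apply: norm_det_le => k l; rewrite !mxE.
Qed.

(** Cramer's rule without division: the adjugate times [A b] is [det A] times [b], and a row of the
    adjugate has [n] entries of modulus at most [(n-1)!]. *)
Lemma cramer_bound n (A : 'M[F]_n) (b : 'cV[F]_n) (s : F) i :
  (forall i j, `|A i j| <= 1) -> (forall j, `|(A *m b) j 0| <= s) ->
  `|\det A| * `|b i 0| <= n`!%:R * s.
Proof.
move=> A1 Ab; have s0 : 0 <= s by exact: le_trans (normr_ge0 _) (Ab i).
have -> : `|\det A| * `|b i 0| = `|(\adj A *m (A *m b)) i 0|.
  by rewrite mulmxA mul_adj_mx mul_scalar_mx mxE normrM.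
rewrite mxE; apply: le_trans (ler_norm_sum _ _ _) _.
apply: (@le_trans _ _ (\sum_(j < n) n.-1`!%:R * s)).
  by apply: ler_sum => j _; rewrite normrM ler_pM// norm_adjugate_le.
rewrite sumr_const card_ord -[_ *+ n]mulr_natl mulrA -natrM.
by case: n A b i A1 Ab => [|n] ? ? [] //= *; rewrite -factS.
Qed.

End DeterminantBounds.

Section SumInequalities.
Variable R : realFieldType.

(* By Lagrange's identity. *)
Lemma cauchy_schwarz_sum n (x y : 'I_n -> R) :
  (\sum_i x i * y i) ^+ 2 <= (\sum_i x i ^+ 2) * (\sum_i y i ^+ 2).
Proof.
have : 0 <= \sum_i \sum_j (x i * y j - x j * y i) ^+ 2.
  by apply: sumr_ge0 => i _; apply: sumr_ge0 => j _; exact: sqr_ge0.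
have -> : \sum_i \sum_j (x i * y j - x j * y i) ^+ 2 =
  \sum_i \sum_j (x i ^+ 2 * y j ^+ 2 + x j ^+ 2 * y i ^+ 2
                 - 2 * ((x i * y i) * (x j * y j))).
  by apply: eq_bigr => i _; apply: eq_bigr => j _; ring.
under eq_bigr => i _ do
  rewrite sumrB big_split/= -mulr_sumr -mulr_suml -!mulr_sumr.
rewrite sumrB big_split/= -mulr_suml -mulr_sumr -mulr_sumr -mulr_suml.
set X := \sum_i x i ^+ 2; set Y := \sum_i y i ^+ 2; set S := \sum_i _ * _.
by rewrite expr2; lra.
Qed.

Lemma sum_sqr_le n (x : 'I_n -> R) : (forall i, 0 <= x i) ->
  \sum_i x i ^+ 2 <= (\sum_i x i) ^+ 2.
Proof.
move=> x0; rewrite expr2 mulr_sumr; apply: ler_sum => i _.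
rewrite expr2 ler_wpM2r// (bigD1 i)//= lerDl.
by apply: sumr_ge0.
Qed.

Lemma sum_inv_sqr_le n : \sum_(t < n) (t.+1%:R ^+ 2)^-1 <= 2 :> R.
Proof.
(* The bound is strengthened so that induction telescopes: [1/(x+1)^2 <= 1/x - 1/(x+1)]. *)
suff: \sum_(t < n.+1) (t.+1%:R ^+ 2)^-1 <= 2 - n.+1%:R^-1 :> R.
  rewrite big_ord_recr/= => h; apply: le_trans (_ : 2 - n.+1%:R^-1 <= _); last first.
    by rewrite lerBlDr lerDl invr_ge0 ler0n.
  by apply: le_trans h; rewrite lerDl invr_ge0 sqr_ge0.
elim: n => [|n IHn]; first by rewrite big_ord1 expr1n invr1; lra.
rewrite big_ord_recr/=; apply: le_trans (lerD IHn (lexx _)) _.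
have n0 : 0 < n.+1%:R :> R by rewrite ltr0n.
have -> : n.+2%:R = n.+1%:R + 1 :> R by rewrite -natr1.
set x : R := n.+1%:R in n0 *.
rewrite -subr_ge0.
have -> : 2 - (x + 1)^-1 - (2 - x^-1 + ((x + 1) ^+ 2)^-1) = (x * (x + 1) ^+ 2)^-1.
  by field; rewrite !gt_eqF// addr_gt0.
by rewrite invr_ge0 mulr_ge0 ?sqr_ge0// ltW.
Qed.

End SumInequalities.

(** * Factorial growth against the weights of the iterated Laplacian *)

Section LaplacianWeights.
Variable R : realFieldType.

Lemma ffact_le n k : (n ^_ k <= n ^ k)%N.
Proof.
elim: k n => [|k IHk] [|n] //=; rewrite ?ffact0n// ffactnS expnS leq_mul//.
by apply: leq_trans (IHk n) _; case: k {IHk} => [|k] //; rewrite leq_exp2r.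
Qed.

Lemma ffact_ge t p : (t.+1 ^ p <= (t + p) ^_ p)%N.
Proof.
elim: p => [|p IHp] //; rewrite addnS ffactSS expnS leq_mul//; lia.
Qed.

(** Up to [4^p], the factor by which the iterated Laplacian multiplies the coefficient of
    [z^(t+p) w^(m-t+p)]. *)
Definition lapweight p m t : nat := ((t + p) ^_ p * (m - t + p) ^_ p)%N.

Lemma lapweight_gt0 p m t : (0 < lapweight p m t)%N.
Proof. by rewrite muln_gt0 !ffact_gt0; lia. Qed.

Lemma lapweight_ge p m t : ((t.+1 * (m - t).+1) ^ p <= lapweight p m t)%N.
Proof. by rewrite expnMn leq_mul// ffact_ge. Qed.

Lemma fact_growth m q : ((m + q)`! <= (m + q) ^ q * m`!)%N.
Proof.
by rewrite -(ffact_fact (leq_addl m q)) addnK leq_mul// ffact_le.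
Qed.

(** With [u = t+1], [v = m-t+1] and [r = (m+1)/(uv)], the factorial quotient is at most
    [(2p(m+1))^(2p)] and the squared weight at least [(uv)^(2p)], which leaves [(2p)^(2p) r^(2p)].
    As [r <= 1] and [r <= 1/u + 1/v], the last power is at most [r^2 <= 2/u^2 + 2/v^2]. *)
Lemma fact_lapweight_le p m t : (0 < p)%N -> (t <= m)%N ->
  (m + p.*2)`!%:R * ((lapweight p m t)%:R ^+ 2)^-1 <=
  (p.*2 ^ p.*2)%:R * m`!%:R *
  (2 * (t.+1%:R ^+ 2)^-1 + 2 * ((m - t).+1%:R ^+ 2)^-1) :> R.
Proof.
move=> p0 tm; set u : R := t.+1%:R; set v : R := (m - t).+1%:R.
have u0 : 0 < u by rewrite ltr0n.
have v0 : 0 < v by rewrite ltr0n.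
set r : R := m.+1%:R / (u * v).
have m0 : 0 < m.+1%:R :> R by rewrite ltr0n.
have r0 : 0 <= r by rewrite divr_ge0 ?mulr_ge0 ?ltW.
have r1 : r <= 1.
  by rewrite ler_pdivrMr ?mulr_gt0// mul1r -natrM ler_nat; nia.
have rle : r <= u^-1 + v^-1.
  have -> : u^-1 + v^-1 = (u + v) / (u * v) by field; rewrite !gt_eqF.
  rewrite ler_wpM2r ?invr_ge0 ?mulr_ge0 ?(ltW u0) ?(ltW v0)//.
  by rewrite -[u + v](natrD _ t.+1 (m - t).+1) ler_nat; lia.
have r2 : r ^+ p.*2 <= 2 * (u ^+ 2)^-1 + 2 * (v ^+ 2)^-1.
  apply: (@le_trans _ _ (r ^+ 2)).
    by apply: ler_wiXn2l => //; lia.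
  apply: (@le_trans _ _ ((u^-1 + v^-1) ^+ 2)).
    by rewrite lerXn2r ?nnegrE// addr_ge0 ?invr_ge0 ?ltW.
  rewrite -!exprVn -subr_ge0; move: u^-1 v^-1 => x y.
  have -> : 2 * x ^+ 2 + 2 * y ^+ 2 - (x + y) ^+ 2 = (x - y) ^+ 2 by ring.
  exact: sqr_ge0.
apply: (@le_trans _ _ ((p.*2 ^ p.*2)%:R * m`!%:R * r ^+ p.*2)); last first.
  by rewrite ler_wpM2l ?mulr_ge0 ?ler0n.
have w0 : 0 < (lapweight p m t)%:R ^+ 2 :> R by rewrite exprn_gt0// ltr0n lapweight_gt0.
have -> : (p.*2 ^ p.*2)%:R * m`!%:R * r ^+ p.*2 =
    ((p.*2 * m.+1) ^ p.*2 * m`!)%:R * ((u * v) ^+ p.*2)^-1 :> R.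
  by rewrite /r expr_div_n expnMn !natrM !natrX; ring.
apply: ler_pM; rewrite ?ler0n ?invr_ge0 ?sqr_ge0//.
  rewrite ler_nat (leq_trans (fact_growth _ _))// leq_mul2r leq_exp2r ?double_gt0//.
  by apply/orP; right; nia.
rewrite lef_pV2 ?posrE ?exprn_gt0 ?mulr_gt0 ?ltr0n ?lapweight_gt0//.
rewrite -muln2 exprM lerXn2r ?nnegrE ?exprn_ge0 ?mulr_ge0 ?ler0n//.
by rewrite -natrM -natrX ler_nat lapweight_ge.
Qed.

(** The reflection [t -> m - t] makes the two sums of inverse squares equal; each is at most 2, and
    [2*2 + 2*2 = 8]. *)
Lemma sum_lapweight_le p m : (0 < p)%N ->
  (m + p.*2)`!%:R * \sum_(t < m.+1) ((lapweight p m t)%:R ^+ 2)^-1 <=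
  8 * (p.*2 ^ p.*2)%:R * m`!%:R :> R.
Proof.
move=> p0; rewrite mulr_sumr.
apply: (@le_trans _ _ (\sum_(t < m.+1) (p.*2 ^ p.*2)%:R * m`!%:R *
    (2 * (t.+1%:R ^+ 2)^-1 + 2 * ((m - t).+1%:R ^+ 2)^-1))).
  by apply: ler_sum => t _; rewrite fact_lapweight_le// leq_ord.
rewrite -mulr_sumr -[8 * _ * _]mulrA [8 * _]mulrC.
rewrite ler_wpM2l ?mulr_ge0 ?ler0n//.
rewrite big_split/= -!mulr_sumr.
rewrite [X in _ + 2 * X](reindex_inj rev_ord_inj)/=.
under [X in _ + 2 * X]eq_bigr => t _ do rewrite subSS subKn ?leq_ord//.
by have := sum_inv_sqr_le R m.+1; lra.
Qed.

End LaplacianWeights.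

(** * Bijectivity and the norm estimate *)

Section ComplexModulus.
Variable R : realType.
Local Notation C := R[i].

(** The norm of [R[i]] takes its values in [R[i]]; real inequalities on [cabs] are proved there and
    brought back. *)
Lemma cabsE (z : C) : ((cabs z)%:C)%C = `|z|.
Proof. by rewrite normc_def. Qed.

Lemma real_complexM (x y : R) : ((x * y)%:C = x%:C * y%:C :> C)%C.
Proof. exact: (rmorphM (real_complex R)). Qed.

Lemma real_complex_nat n : ((n%:R : R)%:C)%C = n%:R :> C.
Proof. exact: (rmorph_nat (real_complex R)). Qed.

Lemma real_complex_sum I (r : seq I) (P : pred I) (F : I -> R) :
  ((\sum_(i <- r | P i) F i)%:C)%C = \sum_(i <- r | P i) ((F i)%:C)%C :> C.
Proof. exact: (rmorph_sum (real_complex R)). Qed.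

Lemma cabs_ge0 (z : C) : 0 <= cabs z.
Proof. exact: sqrtr_ge0. Qed.

Lemma sqr_cabs (z : C) : cabs z ^+ 2 = sqmod z.
Proof. by rewrite sqr_sqrtr ?sqmod_ge0. Qed.

Lemma cabs_eq0 (z : C) : (cabs z == 0) = (z == 0).
Proof. by rewrite -(inj_eq (@complexI R)) cabsE normr_eq0. Qed.

Lemma norm_Acoef (a : R) : `|Acoef a| = 1.
Proof.
have conj_a : (a%:C)%C - 'i%C = ((a%:C)%C + 'i%C)^*%C :> C.
  by apply/eqP; rewrite eq_complex/= oppr0 !addr0 !add0r !eqxx.
rewrite /Acoef normrM normfV conj_a normcJ divff// normr_eq0.
by rewrite eq_complex/= add0r oner_eq0 andbF.
Qed.

Lemma norm_node a j : `|node a j| = 1 :> C.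
Proof. by rewrite /node; case: ifP => _; rewrite ?normr1 ?norm_Acoef. Qed.

End ComplexModulus.

Section Bijectivity.
Variables (R : realType) (p : nat) (a : nat -> R).
Hypothesis p_gt0 : (0 < p)%N.
Hypothesis a_inj : forall j k : nat, (1 <= j < p.*2)%N -> (1 <= k < p.*2)%N ->
     a j = a k -> j = k.
Local Notation C := R[i].
Local Notation B := (bipoly R).
Implicit Types (c d h : {poly C}) (m : nat).

(** The coefficients of the iterated Laplacian of the form of degree [m + 2p] with coefficients
    [c]. *)
Definition lapcoefs m c : {poly C} :=
  \poly_(k < m.+1) (4 ^+ p * (lapweight p m k)%:R * c`_(k + p)).

Definition Pcoefs h : {poly C} := (Pscale p a)^-1 *: (nodal p a * h).

Lemma size_Pcoefs m h : (size h <= m.+1)%N -> (size (Pcoefs h) <= (m + p.*2).+1)%N.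
Proof.
move=> sh; rewrite (leq_trans (size_scale_leq _ _))//.
by rewrite (leq_trans (size_polyMleq _ _))// size_nodal; lia.
Qed.

Lemma Pcoefs_root h j : (j < p.*2)%N -> (Pcoefs h).[node a j] = 0.
Proof.
by move=> jp; rewrite hornerZ hornerM (rootP (nodal_root a jp)) mul0r mulr0.
Qed.

Lemma Pcoefs_eq0 h : Pcoefs h = 0 -> h = 0.
Proof.
move=> /eqP; rewrite scaler_eq0 invr_eq0 (negbTE (Pscale_neq0 p a))/=.
by rewrite mulf_eq0 (negbTE (monic_neq0 (monic_nodal p a)))/= => /eqP.
Qed.

Lemma Fop_zwform m h : (size h <= m.+1)%N ->
  Fop p a (zwform m h) = zwform m (lapcoefs m (Pcoefs h)).
Proof. by move=> sh; rewrite /Fop Pa_zwform// iter_lap_zwform. Qed.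

Lemma lapfactor_neq0 m k : 4 ^+ p * (lapweight p m k)%:R != 0 :> C.
Proof. by rewrite mulf_neq0 ?expf_neq0 ?pnatr_eq0// -lt0n lapweight_gt0. Qed.

Lemma coefs_eq0 m c : (size c <= (m + p.*2).+1)%N ->
  (forall i, (i < p.*2)%N -> c`_(badix m p i) = 0) ->
  (forall t, (t <= m)%N -> c`_(p + t) = 0) -> c = 0.
Proof.
move=> sc bad good; apply/polyP => k; rewrite coef0.
have [kp|pk] := ltnP k p.
  by have := bad k; rewrite /badix kp; apply; lia.
have [km|mk] := leqP k (m + p).
  by have := good (k - p)%N; rewrite subnKC//; apply; lia.
have [kn|nk] := leqP k (m + p.*2); last by rewrite nth_default// (leq_trans sc).
have := bad (k - m - 1)%N; rewrite /badix ifF; last by lia.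
by rewrite (_ : _ + _ = k)%N; [apply; lia|lia].
Qed.

Lemma goodsum_eq0 m c x : (forall t, (t <= m)%N -> c`_(p + t) = 0) ->
  goodsum m p c x = 0.
Proof. by move=> good; apply: big1 => t _; rewrite good ?mul0r// leq_ord. Qed.

Lemma mul_unitmx_eq0 n (A : 'M[C]_n) (b : 'cV[C]_n) :
  \det A != 0 -> A *m b = 0 -> b = 0.
Proof.
move=> dA Ab; have uA : A \in unitmx by rewrite unitmxE unitfE.
by rewrite -(mulKmx uA b) Ab mulmx0.
Qed.

(** The nonzero weights force the middle coefficients to vanish; the outer ones then form a kernel
    vector of the matrix. *)
Lemma lapcoefs_inj m c : \det (Mmat m p a) != 0 ->
  (size c <= (m + p.*2).+1)%N -> (forall j, (j < p.*2)%N -> c.[node a j] = 0) ->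
  (forall k, (k <= m)%N -> (lapcoefs m c)`_k = 0) -> c = 0.
Proof.
move=> dM sc croot lap0.
have good t : (t <= m)%N -> c`_(p + t) = 0.
  move=> tm; have /eqP := lap0 t tm; rewrite coef_poly ltnS tm mulf_eq0.
  by rewrite (negbTE (lapfactor_neq0 m t))/= addnC => /eqP.
have b0 : \col_(i < p.*2) c`_(badix m p i) = 0.
  apply: (mul_unitmx_eq0 dM); apply/matrixP => j i; rewrite (ord1 i).
  by rewrite Mmat_mul// croot// goodsum_eq0// subr0 mxE.
apply: (coefs_eq0 sc) => // i ip.
by have /matrixP/(_ (Ordinal ip) 0) := b0; rewrite !mxE.
Qed.

Lemma Fop_homog m q : homog m q -> homog m (Fop p a q).
Proof.
by move=> /homog_is_zwform[h sh ->]; rewrite Fop_zwform//; exact: homog_zwform.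
Qed.

Lemma Fop_inj m q1 q2 : \det (Mmat m p a) != 0 -> homog m q1 -> homog m q2 ->
  Fop p a q1 = Fop p a q2 -> q1 = q2.
Proof.
move=> dM /homog_is_zwform[h1 s1 ->] /homog_is_zwform[h2 s2 ->].
rewrite !Fop_zwform// => /eqP; rewrite -subr_eq0 -zwformB => /eqP/zwform_eq0 e.
have s12 : (size (h1 - h2)%R <= m.+1)%N.
  by rewrite (leq_trans (size_polyD _ _))// size_polyN geq_max s1.
suff /Pcoefs_eq0/eqP : Pcoefs (h1 - h2) = 0 by rewrite subr_eq0 => /eqP ->.
apply: (lapcoefs_inj dM); first exact: size_Pcoefs.
  by move=> j; exact: Pcoefs_root.
move=> k km; rewrite -[RHS](e k km) coefB !coef_poly ltnS km -mulrBr -coefB.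
by rewrite /Pcoefs -scalerBr -mulrBr.
Qed.

Lemma zwform_ext m c d : (forall k, (k <= m)%N -> c`_k = d`_k) ->
  zwform m c = zwform m d :> B.
Proof. by move=> cd; apply: eq_bigr => k _; rewrite cd// leq_ord. Qed.

Lemma Pcoefs_exists m c : (size c <= (m + p.*2).+1)%N ->
  (forall j, (j < p.*2)%N -> c.[node a j] = 0) ->
  exists2 h : {poly C}, (size h <= m.+1)%N & c = Pcoefs h.
Proof.
move=> sc /(nodal_dvd p_gt0 a_inj sc)[h sh ->]; exists (Pscale p a *: h).
  by rewrite (leq_trans (size_scale_leq _ _)).
by rewrite /Pcoefs scalerAr scalerA mulVf ?Pscale_neq0// scale1r.
Qed.

(** Converse use of [Mmat_mul]: a solution of the linear system for prescribed middle coefficients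
    yields a polynomial vanishing at all nodes, hence a multiple of P_a. *)
Lemma assemble_root m (b : 'cV[C]_p.*2) (s : nat -> C) :
  (forall j : 'I_p.*2, (Mmat m p a *m b) j 0 =
     - \sum_(t < m.+1) s t * node a j ^+ (p + t)) ->
  exists c : {poly C}, [/\ (size c <= (m + p.*2).+1)%N,
    forall i : 'I_p.*2, c`_(badix m p i) = b i 0,
    forall t, (t <= m)%N -> c`_(p + t) = s t &
    forall j, (j < p.*2)%N -> c.[node a j] = 0].
Proof.
(* The column is extended by 0 to a sequence, the form that [assemble] expects. *)
move=> Mb; pose b' i := if insub i is Some j then b j 0 else 0.
have b'E (i : 'I_p.*2) : b' i = b i 0 by rewrite /b' valK.
exists (assemble m p b' s).
have sc : (size (assemble m p b' s) <= (m + p.*2).+1)%N by exact: size_poly.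
have bad (i : 'I_p.*2) : (assemble m p b' s)`_(badix m p i) = b i 0.
  by rewrite assemble_bad.
split=> // [t tm|j jp]; first exact: assemble_good.
have := Mmat_mul a (Ordinal jp) sc.
have -> : \col_i (assemble m p b' s)`_(badix m p i) = b.
  by apply/matrixP => i k; rewrite mxE bad (ord1 k).
rewrite Mb => /eqP; rewrite eq_sym subr_eq => /eqP ->; apply/eqP.
rewrite addrC subr_eq0; apply/eqP; apply: eq_bigr => t _.
by rewrite assemble_good// leq_ord.
Qed.

Lemma Fop_surj m r : \det (Mmat m p a) != 0 -> homog m r ->
  exists q, homog m q /\ Fop p a q = r.
Proof.
move=> dM /homog_is_zwform[s ss ->].
(* The target dictates the middle coefficients; inverting the matrix supplies the outer ones. *)
pose g t := s`_t / (4 ^+ p * (lapweight p m t)%:R).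
pose v : 'cV[C]_p.*2 := \col_j - \sum_(t < m.+1) g t * node a j ^+ (p + t).
have uM : Mmat m p a \in unitmx by rewrite unitmxE unitfE.
have [j|c [sc _ cg croot]] := @assemble_root m (invmx (Mmat m p a) *m v) g.
  by rewrite mulKVmx// mxE.
have [h sh ch] := Pcoefs_exists sc croot.
exists (zwform m h); split; first exact: homog_zwform.
rewrite Fop_zwform// -ch; apply: zwform_ext => k km.
by rewrite coef_poly ltnS km addnC cg// mulrC divfK// lapfactor_neq0.
Qed.

(** For a singular matrix, a kernel vector taken as outer coefficients, with zero middle
    coefficients, gives a nonzero multiple of P_a killed by the iterated Laplacian. *)
Lemma det_neq0 m :
  (forall q1 q2, homog m q1 -> homog m q2 -> Fop p a q1 = Fop p a q2 -> q1 = q2) ->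
  \det (Mmat m p a) != 0.
Proof.
move=> Finj; apply/negP => /eqP d0.
(* [det0P] provides a row vector in the left kernel, hence the transpose. *)
have /det0P[v v0 vM] : \det (Mmat m p a)^T == 0 by rewrite det_tr d0.
have Mv : Mmat m p a *m v^T = 0.
  by rewrite -[Mmat _ _ _]trmxK -trmx_mul vM trmx0.
have [j|c [sc cb cg croot]] := @assemble_root m v^T (fun=> 0).
  by rewrite Mv mxE big1 ?oppr0// => t _; rewrite mul0r.
have [h sh ch] := Pcoefs_exists sc croot.
have h0 : zwform m h = zwform m 0 :> B.
  apply: Finj; [exact: homog_zwform..|].
  rewrite !Fop_zwform ?size_poly0//; apply: zwform_ext => k km.
  rewrite -ch !coef_poly ltnS km addnC cg// mulr0.
  by rewrite /Pcoefs mulr0 scaler0 coef0 mulr0.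
have hz : h = 0.
  rewrite zwform0 in h0; apply/polyP => l; rewrite coef0.
  have [lm|ml] := leqP l m; first exact: (zwform_eq0 h0).
  by rewrite nth_default// (leq_trans sh).
move: v0; apply/negP; rewrite negbK; apply/eqP/matrixP => i k.
rewrite (ord1 i) mxE; have := cb k; rewrite mxE => <-.
by rewrite ch hz /Pcoefs mulr0 scaler0 coef0.
Qed.

End Bijectivity.

(** * The norm estimate with a constant independent of the degree *)

Section Estimate.
Variables (R : realType) (p : nat) (a : nat -> R).
Hypothesis p_gt0 : (0 < p)%N.
Local Notation C := R[i].
Implicit Types (c : {poly C}) (m : nat).

Lemma norm_Mmat m i j : `|Mmat m p a i j| <= 1.
Proof. by rewrite MmatE normrX norm_node expr1n. Qed.

Lemma cabs_det_Mmat m : cabs (\det (Mmat m p a)) <= p.*2`!%:R.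
Proof.
rewrite -lecR cabsE real_complex_nat.
by apply: norm_det_le => i j; exact: norm_Mmat.
Qed.

Lemma cabs_badix_le m c i : (size c <= (m + p.*2).+1)%N ->
  (forall j, (j < p.*2)%N -> c.[node a j] = 0) -> (i < p.*2)%N ->
  cabs (\det (Mmat m p a)) * cabs c`_(badix m p i) <=
  p.*2`!%:R * \sum_(t < m.+1) cabs c`_(p + t).
Proof.
move=> sc croot ip; pose b : 'cV[C]_p.*2 := \col_i c`_(badix m p i).
rewrite -lecR !real_complexM real_complex_nat !cabsE.
have -> : c`_(badix m p i) = b (Ordinal ip) 0 by rewrite mxE.
apply: cramer_bound => [k l|j]; first exact: norm_Mmat.
rewrite Mmat_mul// croot// sub0r normrN real_complex_sum.
apply: le_trans (ler_norm_sum _ _ _) _; apply: ler_sum => t _.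
by rewrite normrM normrX norm_node expr1n mulr1 cabsE.
Qed.

(** Each of the [2p] outer coefficients obeys the Cramer bound; the middle ones together cost one
    more copy, since [(2p)!/|det M| >= 1]. *)
Lemma sum_sqmod_le m c : (size c <= (m + p.*2).+1)%N ->
  (forall j, (j < p.*2)%N -> c.[node a j] = 0) -> \det (Mmat m p a) != 0 ->
  \sum_(k < (m + p.*2).+1) sqmod c`_k <=
  p.*2.+1%:R * (p.*2`!%:R / cabs (\det (Mmat m p a)) *
                \sum_(t < m.+1) cabs c`_(p + t)) ^+ 2.
Proof.
move=> sc croot dM; set D := cabs _; set S := \sum_(t < m.+1) _; set K := p.*2`!%:R.
have D0 : 0 < D by rewrite lt_neqAle cabs_ge0 eq_sym cabs_eq0 dM.
have S0 : 0 <= S by apply: sumr_ge0 => t _; exact: cabs_ge0.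
have KD : 1 <= K / D by rewrite ler_pdivlMr// mul1r cabs_det_Mmat.
have KS : 0 <= K / D * S by rewrite mulr_ge0// (le_trans ler01).
rewrite (sum_badix m p (fun k => sqmod c`_k)) -[p.*2.+1%:R]natr1 mulrDl mul1r.
apply: lerD.
  rewrite -[p.*2 in leRHS](card_ord p.*2) mulr_natl -sumr_const; apply: ler_sum => i _.
  rewrite -sqr_cabs lerXn2r ?nnegrE ?cabs_ge0// mulrAC ler_pdivlMr// mulrC.
  exact: cabs_badix_le.
apply: (@le_trans _ _ (S ^+ 2)).
  under eq_bigr => t _ do rewrite -sqr_cabs.
  by apply: sum_sqr_le => t; exact: cabs_ge0.
by rewrite lerXn2r ?nnegrE// ler_peMl.
Qed.

Lemma sqmodM (z w : C) : sqmod (z * w) = sqmod z * sqmod w.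
Proof.
apply: (@complexI R); rewrite real_complexM -!mul_conjc rmorphM.
by rewrite mulrACA.
Qed.

Lemma sqmod_nat n : sqmod (n%:R : C) = n%:R ^+ 2.
Proof.
apply: (@complexI R); rewrite -mul_conjc conjc_nat.
by rewrite -natrX real_complex_nat natrX expr2.
Qed.

(** Cauchy-Schwarz after multiplying and dividing each coefficient by its weight; the remaining
    factor [4^p >= 1] is dropped. *)
Lemma sqr_sum_cabs_le m c :
  (\sum_(t < m.+1) cabs c`_(p + t)) ^+ 2 <=
  (\sum_(t < m.+1) sqmod (lapcoefs p m c)`_t) *
  \sum_(t < m.+1) ((lapweight p m t)%:R ^+ 2)^-1.
Proof.
have w0 t : (lapweight p m t)%:R != 0 :> R by rewrite pnatr_eq0 -lt0n lapweight_gt0.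
pose x (t : 'I_m.+1) := (lapweight p m t)%:R * cabs c`_(p + t).
pose y (t : 'I_m.+1) : R := (lapweight p m t)%:R^-1.
rewrite (eq_bigr (fun t => x t * y t)) => [|t _]; last by rewrite /x /y mulrC mulKf.
apply: le_trans (cauchy_schwarz_sum x y) _.
rewrite [X in _ <= _ * X](eq_bigr (fun t => y t ^+ 2)) => [|t _]; last first.
  by rewrite exprVn.
rewrite ler_wpM2r ?sumr_ge0// => [t _|]; first exact: sqr_ge0.
apply: ler_sum => t _; rewrite coef_poly ltn_ord !sqmodM -natrX !sqmod_nat.
rewrite /x exprMn sqr_cabs addnC ler_wpM2r ?sqmod_ge0//.
by rewrite ler_peMl ?sqr_ge0// natrX -exprM exprn_ege1// ler1n.
Qed.

(** The factor [2p+1] comes from [sum_sqmod_le], [8 (2p)^(2p)] from [sum_lapweight_le], and [(2p)!]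
    from Cramer's rule; the first two bound squared norms, hence the root. *)
Definition fischer_const : R :=
  Num.sqrt (p.*2.+1%:R * (8 * (p.*2 ^ p.*2)%:R)) * p.*2`!%:R.

Lemma fnorm_estimate m q : \det (Mmat m p a) != 0 -> homog m q ->
  fnorm (Pa p a * q) <=
  fischer_const / cabs (\det (Mmat m p a)) * fnorm (Fop p a q).
Proof.
move=> dM /homog_is_zwform[h sh ->].
rewrite Fop_zwform// Pa_zwform// -/(Pcoefs p a h) !fnorm_zwform.
set c := Pcoefs p a h; set D := cabs _; set g := gmoment R 0 ^+ 2.
have sc : (size c <= (m + p.*2).+1)%N by exact: size_Pcoefs.
have croot j : (j < p.*2)%N -> c.[node a j] = 0 by exact: Pcoefs_root.
pose K : R := p.*2`!%:R; pose N : R := p.*2.+1%:R; pose k : R := 8 * (p.*2 ^ p.*2)%:R.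
set L := \sum_(t < m.+1) sqmod (lapcoefs p m c)`_t.
have D0 : 0 < D by rewrite lt_neqAle cabs_ge0 eq_sym cabs_eq0 dM.
have g0 : 0 <= g by exact: sqr_ge0.
have L0 : 0 <= L by apply: sumr_ge0 => t _; exact: sqmod_ge0.
have KD0 : 0 <= K / D by rewrite divr_ge0 ?ler0n// ltW.
have k0 : 0 <= k by rewrite mulr_ge0 ?ler0n.
have Nk0 : 0 <= N * k by rewrite mulr_ge0 ?ler0n.
have -> : fischer_const / D * Num.sqrt (g * m`!%:R * L) =
    Num.sqrt (N * k * (K / D) ^+ 2 * (g * m`!%:R * L)).
  rewrite (sqrtrM _ (mulr_ge0 Nk0 (sqr_ge0 (K / D)))) (sqrtrM _ Nk0).
  by rewrite sqrtr_sqr ger0_norm// mulrA.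
apply: ler_wsqrtr.
(* The two norms carry the factorials of their degrees, [m + 2p] and [m]; the sum of inverse squared
   weights compensates their quotient uniformly in [m]. *)
apply: (@le_trans _ _ (g * (m + p.*2)`!%:R * (N * (K / D) ^+ 2 *
   (L * \sum_(t < m.+1) ((lapweight p m t)%:R ^+ 2)^-1)))).
  apply: (ler_wpM2l (mulr_ge0 g0 (ler0n _ _))).
  apply: le_trans (sum_sqmod_le sc croot dM) _.
  rewrite exprMn -mulrA ler_wpM2l ?ler0n// ler_wpM2l ?sqr_ge0//.
  exact: sqr_sum_cabs_le.
have := @sum_lapweight_le R p m p_gt0; set Q := \sum_(t < m.+1) (_ ^+ 2)^-1 => bQ.
have -> : g * (m + p.*2)`!%:R * (N * (K / D) ^+ 2 * (L * Q)) =
   g * N * (K / D) ^+ 2 * L * ((m + p.*2)`!%:R * Q) by ring.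
have -> : N * k * (K / D) ^+ 2 * (g * m`!%:R * L) =
   g * N * (K / D) ^+ 2 * L * (k * m`!%:R) by ring.
apply: ler_wpM2l bQ; apply: mulr_ge0 L0; apply: mulr_ge0 (sqr_ge0 _).
exact: mulr_ge0 g0 (ler0n _ _).
Qed.

End Estimate.

Theorem theorem4p1 (R : realType) (p : nat) (a : nat -> R) :
  (0 < p)%N ->
  (forall j k : nat, (1 <= j < p.*2)%N -> (1 <= k < p.*2)%N ->
     a j = a k -> j = k) ->
  (forall j : nat, (1 <= j < p.*2)%N -> a j != 0) ->
  (forall m : nat,
     ((forall q, homog m q -> homog m (Fop p a q)) /\
      (forall q1 q2, homog m q1 -> homog m q2 ->
         Fop p a q1 = Fop p a q2 -> q1 = q2) /\
      (forall r, homog m r -> exists q, homog m q /\ Fop p a q = r))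
     <-> \det (Mmat m p a) != 0) /\
  (exists C : R, 0 <= C /\
     forall m : nat, \det (Mmat m p a) != 0 ->
       forall q, homog m q ->
         fnorm (Pa p a * q) <= C / cabs (\det (Mmat m p a)) * fnorm (Fop p a q)).
Proof.
move=> p_gt0 a_inj _; split=> [m|].
  split=> [[_ [Finj _]]|dM]; first exact: det_neq0 p_gt0 a_inj _ Finj.
  split; first by move=> q; exact: Fop_homog.
  split=> [q1 q2|r]; first exact: Fop_inj.
  exact: Fop_surj.
exists (fischer_const R p); split; first by rewrite mulr_ge0 ?sqrtr_ge0 ?ler0n.
by move=> m dM q; exact: fnorm_estimate.
Qed.
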